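(* Assume [BCRIT](i)(ii), [ID], [PEN] and [CRIT]. Then: (1) $\|\widehat\alpha_n^B-\alpha_0\|_s=o_{P_{V^\infty|Z^\infty}}(1)$ $wpa1(P_{Z^\infty})$ and $Pen(\widehat h_n^B)=O_{P_{V^\infty|Z^\infty}}(1)$ $wpa1(P_{Z^\infty})$. (2) If in addition [LOC] and [BCRIT](iii) hold, then $$\|\widehat\alpha_n^B-\alpha_0\|=O_{P_{V^\infty|Z^\infty}}(\delta_n)\ wpa1(P_{Z^\infty}),\qquad\|\widehat\alpha_n^B-\alpha_0\|_s=O_{P_{V^\infty|Z^\infty}}\big(\|\Pi_n\alpha_0-\alpha_0\|_s+\tau_n\times\delta_n\big)\ wpa1(P_{Z^\infty}).$$ (3) The same holds for the restricted bootstrap estimator $\widehat\alpha_n^{R,B}$ in place of $\widehat\alpha_n^B$: under [BCRIT](i)(ii), [ID], [PEN] and [CRIT], $\|\widehat\alpha_n^{R,B}-\alpha_0\|_s=o_{P_{V^\infty|Z^\infty}}(1)$ $wpa1(P_{Z^\infty})$ and $Pen(\widehat h_n^{R,B})=O_{P_{V^\infty|Z^\infty}}(1)$ $wpa1(P_{Z^\infty})$; and if in addition [LOC] and [BCRIT](iii) hold, then $$\|\widehat\alpha_n^{R,B}-\alpha_0\|=O_{P_{V^\infty|Z^\infty}}(\delta_n)\ wpa1(P_{Z^\infty}),\qquad\|\widehat\alpha_n^{R,B}-\alpha_0\|_s=O_{P_{V^\infty|Z^\infty}}\big(\|\Pi_n\alpha_0-\alpha_0\|_s+\tau_n\times\delta_n\big)\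 wpa1(P_{Z^\infty}).$$ (All objects and the bracketed conditions are defined in the context.)
   Context: MODEL. $Z=(Y',X')'$; $Z_1,Z_2,\dots$ are i.i.d. copies, $Z_i=(Y_i',X_i')'$, $Z^n=(Z_1,\dots,Z_n)$; $P_{Z^\infty}$ is the law of the sequence ($o_P,O_P$ refer to it); $\mathcal X$ is the support of $X$; $\|\cdot\|_e$ is the Euclidean norm; $a_n\asymp b_n$ means $c_1a_n\le b_n\le c_2a_n$ for constants $0<c_1\le c_2<\infty$. $\mathcal A=\Theta\times\mathcal H$ with $\Theta\subset\mathbb R^{d_\theta}$ and $\mathcal H$ a space of functions with norm $\|\cdot\|_{\mathbf H}$; for $\alpha=(\theta',h)$, $\|\alpha\|_s=\|\theta\|_e+\|h\|_{\mathbf H}$. $\rho(Z;\alpha)\in\mathbb R^{d_\rho}$ is a known function, $m(X,\alpha)=E[\rho(Z;\alpha)|X]$, and $\alpha_0=(\theta_0',h_0)\in\mathrm{int}(\Theta)\times\mathcal H$ satisfies $m(X,\alpha_0)=0$ a.s. $\Sigma(X)$ is a positive definite weighting matrix, $\Sigma_0(X)=\mathrm{Var}(\rho(Z;\alpha_0)|X)$, $Q(\alpha)=E[m(X,\alpha)'\Sigma(X)^{-1}m(X,\alpha)]$. ESTIMATOR. $\widehat m(x,\alpha)=\sum_{i=1}^n\rho(Z_i,\alpha)A_n(X_i,x)$ is a consistent estimator of $m$ ($A_n(X_i,x)$ a known measurable function of $X_1,\dots,X_n$), $\widehat\Sigma$ is a consistent estimator of $\Sigma$, $\widehat Q_n(\alpha)=\frac1n\sum_{i=1}^n\widehat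 m(X_i,\alpha)'\widehat\Sigma(X_i)^{-1}\widehat m(X_i,\alpha)$. Sieve: $\mathcal A_{k(n)}=\Theta\times\mathcal H_{k(n)}$, $\mathcal H_{k(n)}=\{h\in\mathcal H:h=\sum_{k\le k(n)}\beta_kq_k\}$ for known basis functions $q_k$, $k(n)\to\infty$. $Pen\ge0$ is a penalty on $\mathcal H$, $\lambda_n=o(1)$. The PSMD (penalized sieve minimum distance) estimator $\widehat\alpha_n=(\widehat\theta_n',\widehat h_n)\in\mathcal A_{k(n)}$ satisfies $\widehat Q_n(\widehat\alpha_n)+\lambda_nPen(\widehat h_n)\le\inf_{\alpha\in\mathcal A_{k(n)}}\{\widehat Q_n(\alpha)+\lambda_nPen(h)\}+o_P(n^{-1})$. BOOTSTRAP. Weights $\omega_{i,n}\ge0$, $i\le n$, are independent of the data with $E[\omega_{i,n}]=1$ and $\lim_n\mathrm{Var}(\omega_{i,n})=\sigma_\omega^2\in(0,\infty)$ for all $i$; $P_{V^\infty|Z^\infty}(\cdot|Z^n)$ is conditional probability, given the data, for functions of data and weights. $\Delta_n=o_{P_{V^\infty|Z^\infty}}(1)$ $wpa1(P_{Z^\infty})$ means: for all $\epsilon>0$, $P_{Z^\infty}(P_{V^\infty|Z^\infty}(|\Delta_n|>\epsilon|Z^n)>\epsilon)\to0$; $\Delta_n=O_{P_{V^\infty|Z^\infty}}(1)$ $wpa1(P_{Z^\infty})$ means: for all $\epsilon>0$ there is $M<\infty$ with $P_{Z^\infty}(P_{V^\infty|Z^\infty}(|\Delta_n|>M|Z^n)>\epsilon)\to0$;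 $O(a_n)$, $o(a_n)$ versions refer to $\Delta_n/a_n$. $\widehat m^B(x,\alpha)=\sum_i\omega_{i,n}\rho(Z_i,\alpha)A_n(X_i,x)$, $\widehat Q_n^B(\alpha)=\frac1n\sum_i\widehat m^B(X_i,\alpha)'\widehat\Sigma(X_i)^{-1}\widehat m^B(X_i,\alpha)$; $\widehat\alpha_n^B=(\widehat\theta_n^{B\prime},\widehat h_n^B)\in\mathcal A_{k(n)}$ is an approximate minimizer of $\widehat Q_n^B(\alpha)+\lambda_nPen(h)$ over $\mathcal A_{k(n)}$, and $\widehat\alpha_n^{R,B}=(\cdot,\widehat h_n^{R,B})$ is an approximate minimizer of the same function over $\{\alpha\in\mathcal A_{k(n)}:\phi(\alpha)=\phi(\widehat\alpha_n)\}$, both up to $o_{P_{V^\infty|Z^\infty}}(n^{-1})$ $wpa1(P_{Z^\infty})$. Here $\phi:\mathbb R^{d_\theta}\times\mathcal H\to\mathbb R$ is a $\|\cdot\|_s$-continuous functional. LOCAL OBJECTS. $\dot m(X)[v]=\partial_\tau m(X,\alpha_0+\tau v)|_{\tau=0}$ (pathwise derivative), $\|v\|^2=E[\dot m(X)[v]'\Sigma(X)^{-1}\dot m(X)[v]]$. $\mathcal A_{os}$ is a convex $\|\cdot\|_s$-neighbourhood of $\alpha_0$ contained in $\{\alpha\in\mathcal A:\|\alpha-\alpha_0\|_s<M_0,\ \lambda_nPen(h)<\lambda_nM_0\}$; $\mathcal A_{osn}=\mathcal A_{os}\cap\mathcal A_{k(n)}$. With $\Pi_n h_0$ as in [ID](ii),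 $\Pi_n\alpha_0=(\theta_0',\Pi_nh_0)$. $\tau_n=\sup\{\|\alpha-\Pi_n\alpha_0\|_s/\|\alpha-\Pi_n\alpha_0\|:\alpha\in\mathcal A_{osn},\|\alpha-\Pi_n\alpha_0\|\ne0\}$. $\bar\delta_{m,n}\downarrow0$, $\delta_n=o(1)$, $\delta_n\le\bar\delta_{m,n}$, and $\bar\delta_{m,n}^*=o(1)$, $\bar\delta_{m,n}^*\ge\delta_n$, are positive sequences. $\mathcal A_{k(n)}^{M_0}=\{\alpha\in\mathcal A_{k(n)}:\lambda_nPen(h)\le\lambda_nM_0\}$, with $M_0$ finite and so large that it contains $\Pi_n\alpha_0$, and contains $\widehat\alpha_n$ with probability arbitrarily close to one for all large $n$. CONDITIONS. [ID] (i) $E[\rho(Z;\alpha)|X]=0$ a.s. iff $\alpha\in\mathcal A$ with $\|\alpha-\alpha_0\|_s=0$; (ii) $\Theta$ is compact with nonempty interior, $\{\mathcal H_k\}_{k\ge1}$ is a non-decreasing sequence of nonempty closed linear subsets of the Banach space $(\mathcal H,\|\cdot\|_{\mathbf H})$ with $\mathcal H=cl(\cup_k\mathcal H_k)$, and there is $\Pi_nh_0\in\mathcal H_{k(n)}$ with $\|\Pi_nh_0-h_0\|_{\mathbf H}=o(1)$; (iii) $Q$ is lower semicontinuous on $(\mathcal A,\|\cdot\|_s)$; (iv) the eigenvalues of $\Sigma(x),\Sigma_0(x)$ are bounded and bounded away from zero uniformly in $x\in\mathcal X$. [PEN] (i) $\lambda_n>0$, $Q(\Pi_n\alpha_0)+o(n^{-1})=O(\lambda_n)=o(1)$;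 (ii) $|Pen(\Pi_nh_0)-Pen(h_0)|=O(1)$, $Pen(h_0)<\infty$; (iii) for every $M$, $\{h\in\mathcal H:Pen(h)\le M\}$ is compact in $(\mathcal H,\|\cdot\|_{\mathbf H})$. [CRIT] (i) $\widehat Q_n(\Pi_n\alpha_0)\le c_0Q(\Pi_n\alpha_0)+o_P(n^{-1})$ for a finite $c_0>0$; (ii) $\widehat Q_n(\alpha)\ge cQ(\alpha)-O_P(\bar\delta_{m,n}^2)$ uniformly over $\mathcal A_{k(n)}^{M_0}$ for a finite $c>0$. [LOC] (i) $m(\cdot,\alpha)$ is continuously pathwise differentiable in $\alpha\in\mathcal A_{os}$ and $\|\alpha-\alpha_0\|\le C\|\alpha-\alpha_0\|_s$ on $\mathcal A_{os}$ for a finite $C$; (ii) $Q(\alpha)\asymp\|\alpha-\alpha_0\|^2$ on $\mathcal A_{os}$; (iii) $\widehat Q_n(\alpha)\ge cQ(\alpha)-O_P(\delta_n^2)$ uniformly over $\mathcal A_{osn}$, and $\max\{\delta_n^2,Q(\Pi_n\alpha_0),\lambda_n,o(n^{-1})\}=\delta_n^2$. [BCRIT] for finite $c_0^*,c^*>0$, $wpa1(P_{Z^\infty})$: (i) $\widehat Q_n^B(\widehat\alpha_n)\le c_0^*\widehat Q_n(\widehat\alpha_n)+o_{P_{V^\infty|Z^\infty}}(n^{-1})$; (ii) $\widehat Q_n^B(\alpha)\ge c^*\widehat Q_n(\alpha)-O_{P_{V^\infty|Z^\infty}}((\bar\delta_{m,n}^* )^2)$ uniformly over $\mathcal A_{k(n)}^{M_0}$;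 (iii) $\widehat Q_n^B(\alpha)\ge c^*\widehat Q_n(\alpha)-O_{P_{V^\infty|Z^\infty}}(\delta_n^2)$ uniformly over $\mathcal A_{osn}$.
   Formalization: O_P in [LOC](iii) needs one constant with probability tending to 1; with the usual O_P the rates' constant may depend on the data-probability level. M_0 must be large enough for the bootstrap penalties too; \hat\Sigma is positive definite; o(1/n) in [PEN](i), [LOC](iii) means every such sequence. *)

(* Defs.v *)
From HB Require Import structures.
From mathcomp Require Import all_boot all_order all_algebra.
From mathcomp Require Import all_classical all_reals all_analysis.

Set Implicit Arguments.
Unset Strict Implicit.
Unset Printing Implicit Defensive.

Import Order.TTheory GRing.Theory Num.Theory.
Import numFieldNormedType.Exports.

Local Open Scope classical_set_scope.
Local Open Scope ring_scope.

Section Vectors.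
Variable R : realType.

(* The library norm on row vectors is the sup norm. *)
Definition enorm d (u : 'rV[R]_d) : R := Num.sqrt (\sum_j u 0 j ^+ 2).

Definition posdef d (S : 'M[R]_d) : Prop :=
  S^T = S /\ forall u : 'rV[R]_d, u != 0 -> 0 < (u *m S *m u^T) 0 0.

(* u' S^-1 u, vectors being rows *)
Definition wsq d (S : 'M[R]_d) (u : 'rV[R]_d) : R := (u *m invmx S *m u^T) 0 0.

End Vectors.

(* Observations Z = (Y, X) are pairs of real tuples, which carry the product
   sigma-algebra; parameters and residuals are row vectors. *)
Notation obs R dY dX := ((dY.-tuple R) * (dX.-tuple R))%type.

Record model (R : realType) := Model {
  dY : nat; dX : nat; dtheta : nat; drho : nat;
  Hsp : completeNormedModType R;
  lawZ : probability (obs R dY dX) R;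
  Theta : set 'rV[R]_dtheta;
  rho : obs R dY dX -> 'rV[R]_dtheta * Hsp -> 'rV[R]_drho;
  mreg : dX.-tuple R -> 'rV[R]_dtheta * Hsp -> 'rV[R]_drho;
  Sigma : dX.-tuple R -> 'M[R]_drho;
  Sigma0 : dX.-tuple R -> 'M[R]_drho;
  alpha0 : 'rV[R]_dtheta * Hsp
}.
Arguments dY {R} m. Arguments dX {R} m. Arguments dtheta {R} m.
Arguments drho {R} m. Arguments Hsp {R} m. Arguments lawZ {R} m.
Arguments Theta {R} m. Arguments rho {R} m. Arguments mreg {R} m.
Arguments Sigma {R} m. Arguments Sigma0 {R} m. Arguments alpha0 {R} m.

Section Model.
Variables (R : realType) (M : model R).

(* Theta x H; the functions of the model are total, but only their values on
   this set are constrained. *)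
Definition Aset : set ('rV[R]_(dtheta M) * Hsp M) := [set a | Theta M a.1].

Definition norms (a : 'rV[R]_(dtheta M) * Hsp M) : R := enorm a.1 + `|a.2|.

(* g is a version of x |-> E[f(Z) | X = x]. *)
Definition cond_exp (f : obs R (dY M) (dX M) -> R) (g : (dX M).-tuple R -> R) :=
  [/\ (lawZ M).-integrable setT (EFin \o f),
      measurable_fun setT g &
      forall B, measurable B ->
        (\int[lawZ M]_(z in snd @^-1` B) (f z)%:E =
         \int[lawZ M]_(z in snd @^-1` B) (g z.2)%:E)%E].

Definition xsupport : set ((dX M).-tuple R) :=
  [set x | forall e : R, 0 < e ->
    (0 < lawZ M [set z | forall j, `|tnth z.2 j - tnth x j| < e]%R)%E].

Definition model_spec : Prop :=
  [/\ forall a j, Aset a ->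
        measurable_fun setT (fun z => rho M z a 0 j) /\
        cond_exp (fun z => rho M z a 0 j) (fun x => mreg M x a 0 j),
      (forall i j, measurable_fun setT (fun x => Sigma M x i j)) /\
        {ae lawZ M, forall z, posdef (Sigma M z.2)},
      forall i j, cond_exp
        (fun z => (rho M z (alpha0 M) 0 i - mreg M z.2 (alpha0 M) 0 i) *
                  (rho M z (alpha0 M) 0 j - mreg M z.2 (alpha0 M) 0 j))
        (fun x => Sigma0 M x i j),
      (Theta M)° (alpha0 M).1 &
      {ae lawZ M, forall z, mreg M z.2 (alpha0 M) = 0}].

Definition Q (a : 'rV[R]_(dtheta M) * Hsp M) : \bar R :=
  (\int[lawZ M]_z (wsq (Sigma M z.2) (mreg M z.2 a))%:E)%E.

Definition mdot (x : (dX M).-tuple R) (v : 'rV[R]_(dtheta M) * Hsp M) :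
  'rV[R]_(drho M) := 'D_v (mreg M x) (alpha0 M).

Definition normw (v : 'rV[R]_(dtheta M) * Hsp M) : \bar R :=
  ((\int[lawZ M]_z (wsq (Sigma M z.2) (mdot z.2 v))%:E) `^ 2^-1)%E.

End Model.

(* W n i is the weight omega_{i,n}; only the indices i < n are used. *)
Record experiment (R : realType) (M : model R) := Experiment {
  disp : measure_display;
  Omega : measurableType disp;
  Pr : probability Omega R;
  Zs : nat -> {RV Pr >-> obs R (dY M) (dX M)};
  Ws : nat -> nat -> {RV Pr >-> R}
}.

Arguments disp {R M} e. Arguments Omega {R M} e. Arguments Pr {R M} e.
Arguments Zs {R M} e. Arguments Ws {R M} e.

Section Experiment.
Variables (R : realType) (M : model R) (E : experiment M).

Definition sample n : Type := n.-tuple (obs R (dY M) (dX M)).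

Definition data n (w : Omega E) : sample n := [tuple Zs E i w | i < n].
Definition weights n (w : Omega E) : n.-tuple R := [tuple Ws E n i w | i < n].

Definition experiment_spec : Prop :=
  [/\ forall i B, measurable B -> Pr E (Zs E i @^-1` B) = lawZ M B,
      forall N B, (forall i, measurable (B i)) ->
        Pr E (\bigcap_(i < N) (Zs E i @^-1` B i)) =
        (\prod_(i < N) Pr E (Zs E i @^-1` B i))%E,
      (* the array of weights is independent of the data sequence *)
      forall N B C, (forall i, measurable (B i)) ->
        (forall n i, measurable (C n i)) ->
        let data_in := \bigcap_(i < N) (Zs E i @^-1` B i) in
        let weights_in :=
          \bigcap_(n < N) \bigcap_(i < n) (Ws E n i @^-1` C n i) in
        Pr E (data_in `&` weights_in) = (Pr E data_in * Pr E weights_in)%E,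
      forall n i, (i < n)%N ->
        (forall w, 0 <= Ws E n i w) /\ ('E_(Pr E)[Ws E n i] = 1)%E &
      exists2 s2 : R, 0 < s2 &
        forall i, (fun n => ('V_(Pr E)[Ws E n i])%E) @ \oo --> s2%:E].

(* Probabilities of events are outer probabilities, so that no measurability
   of estimators or of suprema is needed; on measurable events they are the
   probabilities themselves (measurable_mu_extE). *)
Definition prZ n (A : set (sample n)) : \bar R :=
  mu_ext (Pr E) [set w | A (data n w)].

(* Weights and data being independent, the conditional probability of an event
   about (z, v), given that the sample is z, is the probability of its z-section
   under the law of the weights. *)
Definition prV n (A : set (n.-tuple R)) : \bar R :=
  mu_ext (Pr E) [set w | A (weights n w)].

Local Open Scope ereal_scope.

Definition dstat := forall n, sample n -> \bar R.
Definition bstat := forall n, sample n -> n.-tuple R -> \bar R.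

Definition oP (a : nat -> \bar R) (D : dstat) : Prop :=
  forall e : R, (0 < e)%R ->
    (fun n => prZ [set z | e%:E * a n < `|D n z|]) @ \oo --> 0.

Definition OP (a : nat -> \bar R) (D : dstat) : Prop :=
  forall e : R, (0 < e)%R -> exists2 C : R, (0 < C)%R &
    \forall n \near \oo, prZ [set z | C%:E * a n < `|D n z|] <= e%:E.

(* "wpa1" relations, for statistics of the data and the weights *)
Definition oPV (a : nat -> \bar R) (D : bstat) : Prop :=
  forall e : R, (0 < e)%R ->
    (fun n => prZ [set z | e%:E <
                prV [set v | e%:E * a n < `|D n z v| ] ]) @ \oo --> 0.

Definition OPV (a : nat -> \bar R) (D : bstat) : Prop :=
  forall e : R, (0 < e)%R -> exists2 C : R, (0 < C)%R &
    (fun n => prZ [set z | e%:E <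
                prV [set v | C%:E * a n < `|D n z v| ] ]) @ \oo --> 0.

(* OPV applied to statistics of the data alone: some fixed multiple of a
   bounds D with probability approaching one. This is stronger than OP, where
   the multiple depends on the probability level. *)
Definition OP_wpa1 (a : nat -> \bar R) (D : dstat) : Prop :=
  OPV a (fun n z _ => D n z).

(* The relaxation of OPV in which the multiple depends on the probability level
   of the data too, as it does in OP. *)
Definition OPV_tight (a : nat -> \bar R) (D : bstat) : Prop :=
  forall e : R, (0 < e)%R -> exists2 C : R, (0 < C)%R &
    \forall n \near \oo,
      prZ [set z | e%:E < prV [set v | C%:E * a n < `|D n z v| ] ] <= e%:E.

End Experiment.

Definition inv_n (R : realType) (n : nat) : R := n%:R^-1.

Record procedure (R : realType) (M : model R) := Procedure {
  Aw : forall n, n.-tuple ((dX M).-tuple R) ->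
         (dX M).-tuple R -> (dX M).-tuple R -> R;
  Sigmahat : forall n, sample M n -> (dX M).-tuple R -> 'M[R]_(drho M);
  qbasis : nat -> Hsp M;
  kn : nat -> nat;
  Pen : Hsp M -> \bar R;
  lam : nat -> R;
  PiH : nat -> Hsp M;
  phi : 'rV[R]_(dtheta M) * Hsp M -> R;
  alphahat : forall n, sample M n -> 'rV[R]_(dtheta M) * Hsp M;
  alphaB : forall n, sample M n -> n.-tuple R -> 'rV[R]_(dtheta M) * Hsp M;
  alphaRB : forall n, sample M n -> n.-tuple R -> 'rV[R]_(dtheta M) * Hsp M
}.

Arguments Aw {R M} p {n}. Arguments Sigmahat {R M} p {n}.
Arguments qbasis {R M} p. Arguments kn {R M} p. Arguments Pen {R M} p.
Arguments lam {R M} p. Arguments PiH {R M} p. Arguments phi {R M} p.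
Arguments alphahat {R M} p {n}. Arguments alphaB {R M} p {n}.
Arguments alphaRB {R M} p {n}.

Section Procedure.
Variables (R : realType) (M : model R) (E : experiment M) (T : procedure M).
Local Notation par := ('rV[R]_(dtheta M) * Hsp M)%type.

Definition Hk (k : nat) : set (Hsp M) :=
  [set h | exists b : 'I_k -> R, h = \sum_(j < k) b j *: qbasis T j].

Definition Ak (n : nat) : set par := [set a | Theta M a.1 /\ Hk (kn T n) a.2].

Definition Pia0 (n : nat) : par := ((alpha0 M).1, PiH T n).

Definition mB n (z : sample M n) (v : n.-tuple R) (x : (dX M).-tuple R)
    (a : par) : 'rV[R]_(drho M) :=
  let xs := [tuple (tnth z i).2 | i < n] in
  \sum_(i < n) (tnth v i * Aw T xs (tnth xs i) x) *: rho M (tnth z i) a.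

Definition QnB n (z : sample M n) (v : n.-tuple R) (a : par) : R :=
  n%:R^-1 * \sum_(i < n) wsq (Sigmahat T z (tnth z i).2)
                             (mB z v (tnth z i).2 a).

Definition unit_weights n : n.-tuple R := [tuple 1 | i < n].

Definition mhat n (z : sample M n) (x : (dX M).-tuple R) (a : par) :=
  mB z (unit_weights n) x a.

Definition Qn n (z : sample M n) (a : par) : R :=
  n%:R^-1 * \sum_(i < n) wsq (Sigmahat T z (tnth z i).2)
                             (mhat z (tnth z i).2 a).

Local Open Scope ereal_scope.

(* Consistency is pointwise, in probability. Sigmahat, like the Sigma it
   estimates, has positive definite values; otherwise Qn could be negative. *)
Definition first_stage_spec : Prop :=
  [/\ forall n x i, measurable_fun setT
        (fun xs : n.-tuple ((dX M).-tuple R) => Aw T xs (tnth xs i) x),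
      forall a, Aset a -> {ae lawZ M, forall z,
        oP E (cst 1) (fun n zs => (`|mhat zs z.2 a - mreg M z.2 a|%R)%:E)},
      forall n (zs : sample M n) x, posdef (Sigmahat T zs x) &
      {ae lawZ M, forall z,
        oP E (cst 1)
           (fun n zs => (`|Sigmahat T zs z.2 - Sigma M z.2|%R)%:E)}].

Definition penalized_spec : Prop :=
  [/\ (kn T n @[n --> \oo] --> \oo)%classic,
      forall h, 0 <= Pen T h,
      lam T @ \oo --> (0 : R)%R &
      continuous (phi T)].

Definition approx_min n (c : par -> R) (S : set par) (r : \bar R) (a : par) :=
  S a /\
  (c a)%:E + (lam T n)%:E * Pen T a.2 <=
    ereal_inf [set (c b)%:E + (lam T n)%:E * Pen T b.2 | b in S] + r.

Definition invn (n : nat) : \bar R := (inv_n R n)%:E.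

Definition estimators_spec : Prop :=
  [/\ exists2 r : dstat M, oP E invn r &
        forall n z, approx_min n (Qn z) (Ak n) (r n z) (alphahat T z),
      exists2 r : bstat M, oPV E invn r &
        forall n z v, approx_min n (QnB z v) (Ak n) (r n z v) (alphaB T z v) &
      exists2 r : bstat M, oPV E invn r &
        forall n z v, approx_min n (QnB z v)
          (Ak n `&` [set a | phi T a = phi T (alphahat T z)])
          (r n z v) (alphaRB T z v)].

Definition ID : Prop :=
  [/\ forall a, Aset a ->
        ({ae lawZ M, forall z, mreg M z.2 a = 0%R} <->
         norms (a - alpha0 M)%R = 0%R),
      [/\ compact (Theta M), (Theta M)° !=set0,
          [/\ forall k, Hk k `<=` Hk k.+1, forall k, closed (Hk k) &
              forall k, Hk k !=set0],
          closure (\bigcup_k Hk k) = [set: Hsp M] &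
          (forall n, Hk (kn T n) (PiH T n)) /\
          (fun n => `|PiH T n - (alpha0 M).2|%R) @ \oo --> (0 : R)%R],
      lower_semicontinuous (@Q R M : subspace (@Aset R M) -> \bar R) &
      exists lo hi : R, (0 < lo)%R /\ forall x a, xsupport x ->
        (eigenvalue (Sigma M x) a \/ eigenvalue (Sigma0 M x) a) ->
        (lo <= a <= hi)%R].

Definition small_inv_n (r : nat -> R) : Prop :=
  (fun n => r n * n%:R)%R @ \oo --> (0 : R)%R.

(* "Q(Pia0 n) + o(1/n) = O(lam n)" is required of every o(1/n) sequence. *)
Definition PEN : Prop :=
  [/\ [/\ forall n, (0 < lam T n)%R,
          forall r, small_inv_n r -> exists C : R, \forall n \near \oo,
            `|Q (Pia0 n) + (r n)%:E| <= (C * lam T n)%:E &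
          lam T @ \oo --> (0 : R)%R],
      (exists C : R, \forall n \near \oo,
         `|Pen T (PiH T n) - Pen T (alpha0 M).2| <= C%:E) /\
      Pen T (alpha0 M).2 < +oo &
      forall C : R, compact [set h | Pen T h <= C%:E]].

Definition AkM (M0 : R) (n : nat) : set par :=
  Ak n `&` [set a | (lam T n)%:E * Pen T a.2 <= (lam T n * M0)%:E].

(* M0 is to be "so large" that this holds. Conditions on M0 are used for all
   M0 near +oo: the bootstrap estimators, whose penalty may be a fixed multiple
   of that of alphahat, must lie in AkM M0 as well. *)
Definition bound_spec (M0 : R) : Prop :=
  (\forall n \near \oo, AkM M0 n (Pia0 n)) /\
  (fun n => prZ E [set z : sample M n | ~ AkM M0 n (alphahat T z)]) @ \oo --> 0.

Definition CRIT1 : Prop :=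
  exists2 c0 : R, (0 < c0)%R & exists2 r : dstat M, oP E invn r &
    forall n (z : sample M n),
      (Qn z (Pia0 n))%:E <= c0%:E * Q (Pia0 n) + r n z.

(* "Qn(a) >= c Q(a) - O(b) uniformly over a in S n" *)
Definition lower_bound (bigO : (nat -> \bar R) -> dstat M -> Prop)
    (b : nat -> \bar R) (S : nat -> set par) : Prop :=
  exists2 c : R, (0 < c)%R & exists2 r : dstat M, bigO b r &
    forall n (z : sample M n) a, S n a ->
      c%:E * Q a - r n z <= (Qn z a)%:E.

Definition lower_boundB (b : nat -> \bar R) (S : nat -> set par) : Prop :=
  exists2 c : R, (0 < c)%R & exists2 r : bstat M, OPV E b r &
    forall n (z : sample M n) v a, S n a ->
      (c * Qn z a)%:E - r n z v <= (QnB z v a)%:E.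

Definition sq (b : nat -> R) (n : nat) : \bar R := (b n ^+ 2)%:E.

Definition CRIT2 (dbar : nat -> R) (M0 : R) : Prop :=
  lower_bound (OP E) (sq dbar) (AkM M0).

Definition BCRIT1 : Prop :=
  exists2 c0 : R, (0 < c0)%R & exists2 r : bstat M, oPV E invn r &
    forall n (z : sample M n) v,
      (QnB z v (alphahat T z))%:E <=
      (c0 * Qn z (alphahat T z))%:E + r n z v.

Definition BCRIT2 (dbars : nat -> R) (M0 : R) : Prop :=
  lower_boundB (sq dbars) (AkM M0).

Definition sequences_spec (dbar del dbars : nat -> R) : Prop :=
  [/\ forall n, [/\ (0 < dbar n)%R, (0 < del n)%R & (0 < dbars n)%R],
      {homo dbar : i j / (i <= j)%N >-> (j <= i)%R} /\
        dbar @ \oo --> (0 : R)%R,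
      (forall n, del n <= dbar n)%R /\ del @ \oo --> (0 : R)%R &
      (forall n, del n <= dbars n)%R /\ dbars @ \oo --> (0 : R)%R].

Definition local_set (M0 : R) : set par :=
  [set a | [/\ Aset a, (norms (a - alpha0 M) < M0)%R &
               forall n, (lam T n)%:E * Pen T a.2 < (lam T n * M0)%:E]].

(* A neighbourhood relative to local_set M0: sublevel sets of Pen, being
   compact, have empty interior when Hsp M is infinite-dimensional. The product
   topology is that of norms. *)
Definition local_nbhd (M0 : R) (Aos : set par) : Prop :=
  [/\ Aos `<=` local_set M0, convex_set Aos &
      within (local_set M0) (nbhs (alpha0 M)) Aos].

Definition Aosn (Aos : set par) (n : nat) : set par := Aos `&` Ak n.

(* the linear span of Aos - alpha0, as Aos is convex *)
Definition directions (Aos : set par) : set par :=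
  [set v | exists s a b, [/\ Aos a, Aos b & v = s *: (a - b)%R]].

(* Where a.1 is interior to Theta, a + t *: v stays in Theta x H for small t. *)
Definition pathwise_differentiable (Aos : set par) : Prop :=
  let V := directions Aos in
  let D := Aos `&` [set a | (Theta M)° a.1] in
  (forall v j, V v -> measurable_fun setT (fun x => mdot x v 0%R j)) /\
  {ae lawZ M, forall z, forall a, D a ->
    [/\ forall v, V v -> derivable (mreg M z.2) a v,
        forall (s : R) u v, V u -> V v ->
          'D_(s *: u + v)%R (mreg M z.2) a =
          (s *: 'D_u (mreg M z.2) a + 'D_v (mreg M z.2) a)%R &
        forall v, V v ->
          'D_v (mreg M z.2) b @[b --> within D (nbhs a)] -->
          'D_v (mreg M z.2) a]}.

(* bigO is the reading of O_P in the lower bound for Qn. With OP, the rates hold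
   in the sense of OPV_tight but not of OPV, since a tight remainder in this
   bound need not be dominated by any fixed multiple of del n ^+ 2 with
   probability approaching one; OP_wpa1 is what rates in OPV require. *)
Definition LOC (bigO : (nat -> \bar R) -> dstat M -> Prop)
    (del : nat -> R) (Aos : set par) : Prop :=
  [/\ pathwise_differentiable Aos /\
      (exists C : R, forall a, Aos a ->
         normw (a - alpha0 M)%R <= (C * norms (a - alpha0 M))%:E),
      exists c1 c2 : R, (0 < c1 <= c2)%R /\ forall a, Aos a ->
        c1%:E * normw (a - alpha0 M)%R ^+ 2 <= Q a <=
        c2%:E * normw (a - alpha0 M)%R ^+ 2,
      lower_bound bigO (sq del) (Aosn Aos) &
      forall r, small_inv_n r -> \forall n \near \oo,
        maxe (sq del n) (maxe (Q (Pia0 n)) (maxe (lam T n)%:E (r n)%:E)) =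
        sq del n].

Definition BCRIT3 (del : nat -> R) (Aos : set par) : Prop :=
  lower_boundB (sq del) (Aosn Aos).

(* 0 is adjoined so that the supremum is 0 when no ratio is defined. *)
Definition tau (Aos : set par) (n : nat) : \bar R :=
  ereal_sup (0 |` [set (norms (a - Pia0 n)%R)%:E / normw (a - Pia0 n)%R |
                   a in Aosn Aos n `&` [set a | normw (a - Pia0 n)%R != 0]]).

Definition consistent
    (est : forall n, sample M n -> n.-tuple R -> par) : Prop :=
  oPV E (cst 1) (fun n z v => (norms (est n z v - alpha0 M)%R)%:E) /\
  OPV E (cst 1) (fun n z v => Pen T (est n z v).2).

Definition rates (bigO : (nat -> \bar R) -> bstat M -> Prop)
    (del : nat -> R) (Aos : set par)
    (est : forall n, sample M n -> n.-tuple R -> par) : Prop :=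
  bigO (fun n => (del n)%:E) (fun n z v => normw (est n z v - alpha0 M)%R) /\
  bigO (fun n => (norms (Pia0 n - alpha0 M)%R)%:E + tau Aos n * (del n)%:E)
       (fun n z v => (norms (est n z v - alpha0 M)%R)%:E).

End Procedure.

(* Main.v *)
Require Import Defs.
From HB Require Import structures.
From mathcomp Require Import all_boot all_order all_algebra.
From mathcomp Require Import all_classical all_reals all_analysis.
From mathcomp Require Import measurable_realfun.
From mathcomp Require Import ring lra.
Import Order.TTheory GRing.Theory Num.Theory.
Import numFieldNormedType.Exports.
Local Open Scope classical_set_scope.
Local Open Scope ring_scope.

Set Implicit Arguments.
Unset Strict Implicit.
Unset Printing Implicit Defensive.

(** The penalized bootstrap criterion of either bootstrap estimator is at most
    its value at the estimator computed from the data, which satisfies the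
    restriction; that value is controlled by the original criterion at the same
    point, and hence by the penalized criterion at the sieve approximation of
    the truth. All remainders are of order [o(1/n)], and [1/n = O(lam)]
    ([inv_n_le_lam]), so the penalized bootstrap criterion is at most [K * lam]
    with high probability ([criterion_bound]). In particular the penalty is at
    most [K], with [K] fixed before any cutoff [M0] on the penalty: this is why
    the cutoff only has to be large.

    Consistency. The two lower bounds on the criteria turn this into
    [Q = o(1)] at the bootstrap estimator. The parameters with penalty at most
    [K] form a compact set on which [Q] is lower semicontinuous and vanishes
    only at the truth, so [Q] is bounded below away from the truth
    ([Q_separated]) and the estimator must approach it ([norms_unlikely]).

    Rates. Once the estimator lies in the local neighbourhood, the sharper local
    lower bounds give [Q = O(del ^+ 2)], and the equivalence of [Q] with the
    squared weighted norm gives the first rate. For the second, [tau] compares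
    the two norms at the difference between the estimator and the sieve point,
    whose weighted norm is [O(del)] ([norms_le_rate]). The supremum defining
    [tau] leaves out the points at weighted distance zero from the sieve point,
    which need a separate argument ([null_trichotomy]): either
    some local sieve point is at positive distance, and by convexity [tau] is
    infinite as soon as the left-out point differs from the sieve point
    ([tau_pinfty]); or no two local sieve points are ever separated, and all of
    them are the truth itself ([unseparated_trivial]).

    Estimators are arbitrary functions and probabilities are outer
    probabilities, so only monotonicity and subadditivity are available. Every
    step is therefore an inclusion of a bad event in a finite union of bad
    events, whose sizes are recorded by [unlikely]. *)

(** * Stochastic orders under outer probabilities *)

Section StochasticOrder.
Variables (R : realType) (M : model R) (E : experiment M).
Local Open Scope ereal_scope.

Lemma prZ_ge0 n (A : set (sample M n)) : 0 <= prZ E A.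
Proof. exact: mu_ext_ge0. Qed.

Lemma le_prZ n (A B : set (sample M n)) : A `<=` B -> prZ E A <= prZ E B.
Proof. by move=> AB; apply: le_mu_ext => w; exact: AB. Qed.

Lemma prZU n (A B : set (sample M n)) :
  prZ E (A `|` B) <= prZ E A + prZ E B.
Proof. exact: (outer_measureU2 (mu_ext (Pr E))). Qed.

Lemma le_prV n (A B : set (n.-tuple R)) : A `<=` B -> prV E A <= prV E B.
Proof. by move=> AB; apply: le_mu_ext => w; exact: AB. Qed.

Lemma prVU n (A B : set (n.-tuple R)) :
  prV E (A `|` B) <= prV E A + prV E B.
Proof. exact: (outer_measureU2 (mu_ext (Pr E))). Qed.

Lemma prV0 n : prV E (@set0 (n.-tuple R)) = 0.
Proof. exact: mu_ext0. Qed.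

Lemma prVT n : prV E [set: n.-tuple R] = 1.
Proof.
rewrite /prV (_ : [set w | _] = setT); last exact/seteqP.
by rewrite measurable_mu_extE//; exact: probability_setT.
Qed.

Definition unlikelyZ (d : R) (B : forall n, set (sample M n)) :=
  forall eta : R, (0 < eta)%R ->
    \forall n \near \oo, prZ E (B n) <= (d + eta)%:E.

(** At [d = 0] and for all [e] this is smallness of the conditional
    probability, with probability approaching one; a positive [d] records the
    probability of the exceptional data that a tight remainder leaves out. *)
Definition unlikely (e d : R) (B : forall n, sample M n -> set (n.-tuple R)) :=
  unlikelyZ d (fun n => [set z | e%:E < prV E (B n z)]).

Lemma sub_unlikelyZ d (B B' : forall n, set (sample M n)) :
  (\forall n \near \oo, B n `<=` B' n) -> unlikelyZ d B' -> unlikelyZ d B.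
Proof.
move=> BB' B'd eta eta0; near=> n; apply: (@le_trans _ _ (prZ E (B' n))).
  by apply: le_prZ; near: n.
by near: n; exact: B'd.
Unshelve. all: by end_near. Qed.

Lemma unlikelyZU d1 d2 (B1 B2 : forall n, set (sample M n)) :
  unlikelyZ d1 B1 -> unlikelyZ d2 B2 ->
  unlikelyZ (d1 + d2) (fun n => B1 n `|` B2 n).
Proof.
move=> B1d B2d eta eta0; near=> n; apply: (le_trans (prZU _ _)).
rewrite [eta]splitr addrACA EFinD leeD//; near: n;
  [apply: B1d | apply: B2d]; exact: divr_gt0.
Unshelve. all: by end_near. Qed.

Lemma sub_unlikely e d (B B' : forall n, sample M n -> set (n.-tuple R)) :
  (\forall n \near \oo, forall z, B n z `<=` B' n z) ->
  unlikely e d B' -> unlikely e d B.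
Proof.
move=> BB'; apply: sub_unlikelyZ; near=> n => z /= /lt_le_trans; apply.
apply: le_prV; move: z; near: n; exact: BB'.
Unshelve. all: by end_near. Qed.

Lemma unlikelyU e1 e2 d1 d2 (B1 B2 : forall n, sample M n -> set (n.-tuple R)) :
  unlikely e1 d1 B1 -> unlikely e2 d2 B2 ->
  unlikely (e1 + e2) (d1 + d2) (fun n z => B1 n z `|` B2 n z).
Proof.
move=> B1d B2d; apply: sub_unlikelyZ (unlikelyZU B1d B2d).
near=> n => z /=; apply: contraPP => /not_orP[/negP + /negP].
rewrite -!leNgt => h1 h2; apply/negP; rewrite -leNgt.
by rewrite (le_trans (prVU _ _))// EFinD leeD.
Unshelve. all: by end_near. Qed.

Lemma unlikelyZW e d (B : forall n, set (sample M n)) : (0 <= e)%R ->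
  unlikelyZ d B -> unlikely e d (fun n z => [set _ | B n z]).
Proof.
move=> e0; apply: sub_unlikelyZ; near=> n => z /=; apply: contraPP => nB.
rewrite (_ : [set _ | _] = set0) ?prV0; last by apply/seteqP; split.
by apply/negP; rewrite -leNgt lee_fin.
Unshelve. all: by end_near. Qed.

Lemma unlikelyZ_cvg (B : forall n, set (sample M n)) :
  unlikelyZ 0 B <-> (fun n => prZ E (B n)) @ \oo --> 0.
Proof.
split=> [B0|Bcvg eta eta0].
  apply/fine_cvgP; split.
    near=> n; rewrite ge0_fin_numE ?prZ_ge0//.
    by apply: (@le_lt_trans _ _ (0 + 1)%:E); [near: n; exact: B0|exact: ltry].
  apply/cvgrPdist_le => eta eta0; near=> n.
  have : prZ E (B n) <= (0 + eta)%:E by near: n; exact: B0.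
  have := prZ_ge0 (B n); rewrite sub0r normrN /=.
  case: (prZ E (B n)) => // r; rewrite !lee_fin add0r /= => r0 rle.
  by rewrite ger0_norm.
move/fine_cvgP : Bcvg => [Bfin /cvgrPdist_le/(_ _ eta0) Bcvg].
near=> n; have /fineK <- : prZ E (B n) \is a fin_num by near: n.
rewrite lee_fin add0r; apply: (le_trans (ler_norm _)).
by rewrite -normrN -sub0r; near: n.
Unshelve. all: by end_near. Qed.

Lemma oP_unlikely (a : nat -> \bar R) (D : dstat M) (e : R) : (0 < e)%R ->
  oP E a D -> unlikelyZ 0 (fun n => [set z | e%:E * a n < `|D n z|]).
Proof. by move=> e0 /(_ _ e0) /unlikelyZ_cvg. Qed.

(** The relation bounds the statistic and the conditional probability by the
    same constant; at [Num.min e c] it implies the bound with [e] and [c]. *)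
Lemma oPV_unlikely (a : nat -> \bar R) (D : bstat M) (e c : R) :
  (0 < e)%R -> (0 < c)%R -> (\forall n \near \oo, 0 <= a n) -> oPV E a D ->
  unlikely e 0 (fun n z => [set v | c%:E * a n < `|D n z v|]).
Proof.
move=> e0 c0 a0 /(_ (Num.min e c)); rewrite lt_min e0 c0 => /(_ isT).
move/unlikelyZ_cvg; apply: sub_unlikelyZ; near=> n => z /= h.
have an0 : 0 <= a n by near: n.
apply: (@le_lt_trans _ _ e%:E).
  by rewrite lee_fin ge_min lexx.
apply: (lt_le_trans h); apply: le_prV => v /=; apply: le_lt_trans.
by rewrite lee_wpmul2r// lee_fin ge_min lexx orbT.
Unshelve. all: by end_near. Qed.

Lemma OP_unlikely (a : nat -> \bar R) (D : dstat M) (d : R) : (0 < d)%R ->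
  OP E a D -> exists2 C : R, (0 < C)%R &
    unlikelyZ d (fun n => [set z | C%:E * a n < `|D n z|]).
Proof.
move=> d0 /(_ _ d0)[C C0 HC]; exists C => // eta eta0; near=> n.
apply: (@le_trans _ _ d%:E); first by near: n.
by rewrite lee_fin lerDl ltW.
Unshelve. all: by end_near. Qed.

(** Conditional probabilities of events about the data alone are zero or one,
    so a single level determines the multiple. *)
Lemma OP_wpa1_unlikely (a : nat -> \bar R) (D : dstat M) : OP_wpa1 E a D ->
  exists2 C : R, (0 < C)%R &
    unlikelyZ 0 (fun n => [set z | C%:E * a n < `|D n z|]).
Proof.
have h0 : (0 < 2^-1 :> R)%R by rewrite invr_gt0.
move=> /(_ _ h0)[C C0 /unlikelyZ_cvg HC]; exists C => //.
apply: sub_unlikelyZ HC; near=> n => z /= h.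
rewrite (_ : [set _ | _] = setT) ?prVT ?lte_fin ?invf_lt1 ?ltr1n//.
by apply/seteqP; split.
Unshelve. all: by end_near. Qed.

Lemma OPV_unlikely (a : nat -> \bar R) (D : bstat M) (e : R) : (0 < e)%R ->
  OPV E a D -> exists2 C : R, (0 < C)%R &
    unlikely e 0 (fun n z => [set v | C%:E * a n < `|D n z v|]).
Proof. by move=> e0 /(_ _ e0)[C C0 /unlikelyZ_cvg ?]; exists C. Qed.

Lemma cvg_mul_sqr (C : R) (b : nat -> R) : b @ \oo --> (0 : R)%R ->
  (fun n => C * b n ^+ 2)%R @ \oo --> (0 : R)%R.
Proof.
move=> b0; rewrite -(mulr0 C) -[X in (C * X)%R](mulr0 0%R); apply: cvgMr.
by under eq_fun do rewrite expr2; exact: cvgM.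
Qed.

(** As [b] vanishes, the multiple of [b n ^+ 2] in the stochastic bound falls
    below any fixed [c], however large the multiple that the level requires. *)
Lemma OP_sq_unlikely (b : nat -> R) (D : dstat M) (c : R) : (0 < c)%R ->
  b @ \oo --> (0 : R)%R -> OP E (sq b) D ->
  unlikelyZ 0 (fun n => [set z | c%:E < `|D n z|]).
Proof.
move=> c0 b0 HD eta eta0; have [C C0 HC] := HD _ eta0.
have b2 := cvg_mul_sqr C b0.
near=> n; rewrite add0r; apply: (@le_trans _ _
    (prZ E [set z | C%:E * sq b n < `|D n z|])); last by near: n.
apply: le_prZ => z /=; apply: le_lt_trans; rewrite /sq -EFinM lee_fin.
by apply: ltW; near: n; exact: (cvgr_lt _ b2).
Unshelve. all: by end_near. Qed.

Lemma OPV_sq_unlikely (b : nat -> R) (D : bstat M) (e c : R) :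
  (0 < e)%R -> (0 < c)%R -> b @ \oo --> (0 : R)%R -> OPV E (sq b) D ->
  unlikely e 0 (fun n z => [set v | c%:E < `|D n z v|]).
Proof.
move=> e0 c0 b0 /(OPV_unlikely e0)[C C0].
have b2 := cvg_mul_sqr C b0.
apply: sub_unlikely; near=> n => z v /=; apply: le_lt_trans.
rewrite /sq -EFinM lee_fin; apply: ltW; near: n; exact: (cvgr_lt _ b2).
Unshelve. all: by end_near. Qed.

Lemma unlikely_OPV (a : nat -> \bar R) (D : bstat M) :
  (forall e : R, (0 < e)%R -> exists2 C : R, (0 < C)%R &
     unlikely e 0 (fun n z => [set v | C%:E * a n < `|D n z v|])) ->
  OPV E a D.
Proof. by move=> aD e /aD[C C0 /unlikelyZ_cvg ?]; exists C. Qed.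

Lemma unlikely_OPV_tight (a : nat -> \bar R) (D : bstat M) :
  (forall e : R, (0 < e)%R -> exists2 C : R, (0 < C)%R &
     unlikely e (e / 2) (fun n z => [set v | C%:E * a n < `|D n z v|])) ->
  OPV_tight E a D.
Proof.
move=> aD e e0; have [C C0 HC] := aD e e0; exists C => //.
by have := HC (e / 2)%R; rewrite -splitr; apply; rewrite divr_gt0.
Qed.

End StochasticOrder.

(** * Positive definite weights and weighted integrals *)

Section QuadraticForm.
Variables (R : realType) (d : nat).
Implicit Types (S : 'M[R]_d) (u v : 'rV[R]_d).

Lemma posdef_unitmx S : posdef S -> S \in unitmx.
Proof.
move=> [_ Spos]; rewrite -row_free_unit -kermx_eq0; apply/negPn/negP => kS0.
have := Spos (nz_row (kermx S)); rewrite nz_row_eq0 => /(_ kS0).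
have /sub_kermxP -> := nz_row_sub (kermx S).
by rewrite mul0mx mxE ltxx.
Qed.

Lemma wsqE S u : posdef S ->
  wsq S u = (u *m invmx S *m S *m (u *m invmx S)^T) 0 0.
Proof.
move=> Spd; have Su := posdef_unitmx Spd.
by rewrite mulmxKV// trmx_mul trmx_inv Spd.1 /wsq mulmxA.
Qed.

Lemma wsq_ge0 S u : posdef S -> 0 <= wsq S u.
Proof.
move=> Spd; rewrite wsqE//.
have [->|nz] := eqVneq (u *m invmx S) 0; first by rewrite !mul0mx mxE.
exact/ltW/Spd.2.
Qed.

Lemma wsq_eq0 S u : posdef S -> wsq S u = 0 -> u = 0.
Proof.
move=> Spd; rewrite wsqE//; have Su := posdef_unitmx Spd.
have [u0 _|/Spd.2 /gt_eqF/eqP//] := eqVneq (u *m invmx S) 0.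
by rewrite -(mulmxKV Su u) u0 mul0mx.
Qed.

Lemma wsqZ S a u : wsq S (a *: u) = a ^+ 2 * wsq S u.
Proof.
by rewrite /wsq linearZ /= -scalemxAl -scalemxAr -scalemxAl !mxE mulrA expr2.
Qed.

Lemma wsqD S u v : wsq S (u + v) + wsq S (u - v) = 2 * wsq S u + 2 * wsq S v.
Proof.
rewrite /wsq [(u + v)^T]linearD [(u - v)^T]linearB /=.
rewrite !mulmxDl !mulmxDr !(mulNmx, mulmxN).
rewrite !mxE; lra.
Qed.

(** The parallelogram identity, one square being dropped. *)
Lemma wsq_lin_le S a u v : posdef S ->
  wsq S (a *: u + v) <= 2 * a ^+ 2 * wsq S u + 2 * wsq S v.
Proof.
move=> Spd; have := wsqD S (a *: u) v.
have := wsq_ge0 (a *: u - v) Spd; rewrite !wsqZ; lra.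
Qed.

End QuadraticForm.

Section MeasurableForm.
Context {R : realType} {dT : measure_display} {T : measurableType dT}.

(** Division by zero gives zero, so the real power function with exponent [-1]
    yields the inverse on both sides of the origin: [x^-1 = x * (x^2)^(-1)]. *)
Lemma measurable_invr : measurable_fun setT (fun x : R => x^-1).
Proof.
rewrite (_ : (fun x => _) = (fun x => x * ((x ^+ 2) `^ (-1)))); last first.
  apply/funext => x; rewrite powR_inv1 ?sqr_ge0// expr2.
  have [->|x0] := eqVneq x 0; first by rewrite invr0 mul0r.
  by rewrite invfM mulrA divff// mul1r.
apply: measurable_funM; first exact: measurable_id.
apply: (measurableT_comp (measurable_powR (-1))).
by apply: measurable_funX; exact: measurable_id.
Qed.

Lemma measurable_det d (S : T -> 'M[R]_d) :
  (forall i j, measurable_fun setT (fun z => S z i j)) ->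
  measurable_fun setT (fun z => \det (S z)).
Proof.
move=> mS; rewrite /determinant; apply: measurable_sum => s.
by apply: measurable_funM => //; apply: measurable_prod.
Qed.

Lemma measurable_invmx d (S : T -> 'M[R]_d) i j :
  (forall i j, measurable_fun setT (fun z => S z i j)) ->
  measurable_fun setT (fun z => invmx (S z) i j).
Proof.
move=> mS.
have mdet := measurable_det mS.
rewrite (_ : (fun z => _) = (fun z => if \det (S z) != 0
    then (\det (S z))^-1 * \adj (S z) i j else S z i j)); last first.
  by apply/funext => z; rewrite /invmx unitmxE unitfE; case: ifP; rewrite ?mxE.
have mnz : measurable_fun setT (fun z => \det (S z) != 0).
  apply: (measurable_neg (f := fun z => \det (S z) == 0)).
  exact: (@measurable_fun_eqr _ _ _ _ _ (cst 0)).
apply: measurable_fun_ifT => //.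
apply: measurable_funM; first exact: measurableT_comp measurable_invr mdet.
under eq_fun do rewrite mxE /cofactor.
apply: measurable_funM => //; apply: measurable_det => k l.
by under eq_fun do rewrite !mxE; exact: mS.
Qed.

Lemma measurable_wsq d (S : T -> 'M[R]_d) (u : T -> 'rV[R]_d) :
  (forall i j, measurable_fun setT (fun z => S z i j)) ->
  (forall j, measurable_fun setT (fun z => u z 0 j)) ->
  measurable_fun setT (fun z => wsq (S z) (u z)).
Proof.
move=> mS mu; rewrite /wsq; under eq_fun do rewrite mxE.
apply: measurable_sum => j; under eq_fun do rewrite !mxE.
apply: measurable_funM => //; apply: measurable_sum => i.
by apply: measurable_funM => //; exact: measurable_invmx.
Qed.

End MeasurableForm.

Section WeightedNorm.
Context {R : realType} {dT : measure_display} {T : measurableType dT}.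
Variables (P : {measure set T -> \bar R}) (d : nat) (S : T -> 'M[R]_d).
Hypothesis mS : forall i j, measurable_fun setT (fun z => S z i j).
Hypothesis Spd : {ae P, forall z, posdef (S z)}.
Local Open Scope ereal_scope.

(** Both the criterion [Q] and the square of [normw] have this form. *)
Definition wint (u : T -> 'rV[R]_d) : \bar R :=
  \int[P]_z (wsq (S z) (u z))%:E.

Definition mrow (u : T -> 'rV[R]_d) :=
  forall j, measurable_fun setT (fun z => u z 0%R j).

Lemma measurable_EFin_wsq u : mrow u ->
  measurable_fun setT (fun z => (wsq (S z) (u z))%:E).
Proof. by move=> mu; have /measurable_EFinP := measurable_wsq mS mu. Qed.

(** The weights are positive definite only almost everywhere; replacing the
    integrand by its absolute value brings the theory of nonnegative integrals
    to bear. *)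
Lemma wintE u : mrow u -> wint u = \int[P]_z `|(wsq (S z) (u z))%:E|.
Proof.
move=> mu; have mw := measurable_EFin_wsq mu.
apply: ae_eq_integral => //; first exact: measurableT_comp.
by apply: filterS Spd => z pz _ /=; rewrite ger0_norm// wsq_ge0.
Qed.

Lemma wint_ge0 u : mrow u -> 0 <= wint u.
Proof. by move=> mu; rewrite wintE//; apply: integral_ge0 => z _. Qed.

Lemma wint_eq0 u : mrow u -> wint u = 0 -> {ae P, forall z, u z = 0%R}.
Proof.
move=> mu; have mw := measurable_EFin_wsq mu; rewrite wintE//.
move=> /(ae_eq_integral_abs _ measurableT mw) w0.
by apply: filterS2 w0 Spd => z /= /(_ I)[w0] pz; exact: wsq_eq0 pz w0.
Qed.

(** Minkowski's inequality up to a factor, which the constants in the rates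
    absorb. *)
Lemma wint_lin_le (a : R) u v w : mrow u -> mrow v -> mrow w ->
  {ae P, forall z, w z = (a *: u z + v z)%R} ->
  wint w <= (2 * a ^+ 2)%:E * wint u + 2%:E * wint v.
Proof.
move=> mu mv mw wE; rewrite !wintE//.
have mabs x : mrow x -> measurable_fun setT (fun z => `|(wsq (S z) (x z))%:E|).
  move=> mx; apply: measurableT_comp => //.
  exact: measurable_EFin_wsq.
have a0 : (0 <= 2 * a ^+ 2)%R by rewrite mulr_ge0// sqr_ge0.
rewrite -!ge0_integralZl//; [|exact: mabs..].
rewrite -ge0_integralD//; last 3 first.
- by move=> z _; rewrite mule_ge0.
- by apply: measurable_funeM; exact: mabs.
- by apply: measurable_funeM; exact: mabs.
apply: ae_ge0_le_integral => //; first exact: mabs.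
- by move=> z _; rewrite adde_ge0// mule_ge0.
- by apply: emeasurable_funD; apply: measurable_funeM; exact: mabs.
apply: filterS2 wE Spd => z wz pz _; rewrite wz /= -!EFinM -EFinD lee_fin.
rewrite !ger0_norm ?wsq_ge0//; exact: wsq_lin_le.
Qed.

End WeightedNorm.

(** * Distances and identification *)

Section Distances.
Variable R : realType.

Lemma enorm_ge0 d (u : 'rV[R]_d) : 0 <= enorm u.
Proof. exact: sqrtr_ge0. Qed.

Lemma enorm0 d : enorm (0 : 'rV[R]_d) = 0.
Proof. by rewrite /enorm big1 ?sqrtr0// => j _; rewrite mxE expr0n. Qed.

Lemma continuous_enorm d : continuous (@enorm R d).
Proof.
move=> u; apply: (@continuous_comp _ _ _ (fun v : 'rV[R]_d => \sum_j v 0 j ^+ 2)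
  Num.sqrt); last exact: sqrt_continuous.
elim: (index_enum _) => [|j s IHs].
  rewrite (_ : (fun v : 'rV_d => _) = cst 0); first exact: cst_continuous.
  by apply/funext => v; rewrite big_nil.
rewrite (_ : (fun v : 'rV_d => _) =
    (fun v => v 0 j ^+ 2 + \sum_(i <- s) v 0 i ^+ 2)); last first.
  by apply/funext => v; rewrite big_cons.
apply: (@continuousD _ _ _ (fun v : 'rV[R]_d => v 0 j ^+ 2)) => //.
apply: (@continuous_comp _ _ _ (fun v : 'rV[R]_d => v 0 j) (fun x => x ^+ 2)).
  exact: coord_continuous.
exact: exprn_continuous.
Qed.

Variable M : model R.
Local Notation par := ('rV[R]_(dtheta M) * Hsp M)%type.

Lemma norms_ge0 (a : par) : 0 <= norms a.
Proof. by rewrite addr_ge0// enorm_ge0. Qed.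

Lemma continuous_norms : continuous (@norms R M).
Proof.
move=> a; apply: (@continuousD _ _ _ (fun b : par => enorm b.1)
  (fun b : par => `|b.2|)).
  apply: (@continuous_comp _ _ _ fst (@enorm R _)); first exact: cvg_fst.
  exact: continuous_enorm.
apply: (@continuous_comp _ _ _ snd (fun h : Hsp M => `|h|)).
  exact: cvg_snd.
exact: norm_continuous.
Qed.

(** The sieve point has the true finite-dimensional parameter, so the Euclidean
    components of the first and last distances agree. *)
Lemma ler_norms_Pia0 (T : procedure M) n (a : par) :
  norms (a - alpha0 M) <=
  norms (Pia0 T n - alpha0 M) + norms (a - Pia0 T n).
Proof.
rewrite /norms /= subrr enorm0 add0r addrCA lerD2l addrC.
by rewrite -[a.2 - _](subrKA (PiH T n)) ler_normD.
Qed.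

End Distances.

Section Identification.
Variables (R : realType) (M : model R) (T : procedure M).
Hypotheses (hM : model_spec M) (hID : ID T).
Local Notation par := ('rV[R]_(dtheta M) * Hsp M)%type.
Local Open Scope ereal_scope.

Lemma measurable_Sigma i j :
  measurable_fun setT (fun z : obs R (dY M) (dX M) => Sigma M z.2 i j).
Proof.
by case: hM => _ [mS _] _ _ _; exact: measurableT_comp (mS i j) measurable_snd.
Qed.

Lemma ae_posdef_Sigma : {ae lawZ M, forall z, posdef (Sigma M z.2)}.
Proof. by case: hM => _ []. Qed.

Lemma mrow_mreg (a : par) : Aset a ->
  mrow (fun z : obs R (dY M) (dX M) => mreg M z.2 a).
Proof.
move=> Aa j; case: hM => /(_ a j Aa)[_ [_ ma _]] _ _ _ _.
exact: measurableT_comp ma measurable_snd.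
Qed.

Lemma Q_ge0 (a : par) : Aset a -> 0 <= Q a.
Proof.
move=> /mrow_mreg; exact: (wint_ge0 measurable_Sigma ae_posdef_Sigma).
Qed.

Lemma Q_eq0 (a : par) : Aset a -> Q a = 0 -> norms (a - alpha0 M)%R = 0%R.
Proof.
move=> Aa Qa0; case: hID => idA _ _ _; apply/(idA a Aa).
exact: (wint_eq0 measurable_Sigma ae_posdef_Sigma (mrow_mreg Aa)).
Qed.

(** Bounded penalties confine the parameter to a compact set. Around each of its
    points, either all distances to the truth are below [e], or the positive
    value of the lower semicontinuous [Q] there bounds [Q] from below, and
    compactness makes the bound uniform. *)
Lemma Q_separated (hP : PEN T) (K e : R) : (0 < e)%R ->
  exists2 c : R, (0 < c)%R &
    forall a : par, Aset a -> Pen T a.2 <= K%:E ->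
      (e <= norms (a - alpha0 M))%R -> c%:E < Q a.
Proof.
move=> e0.
have cK : compact (@Theta R M `*` [set h | Pen T h <= K%:E]).
  apply: compact_setX; first by case: hID => _ [].
  by case: hP => _ _; exact.
pose P (c : R) (a : par) :=
  Aset a -> (e <= norms (a - alpha0 M))%R -> c%:E < Q a.
have Pc : \forall c \near (0%R : R)^'+,
    @Theta R M `*` [set h | Pen T h <= K%:E] `<=` P c.
  apply: (proj1 (compact_near_coveringP _) cK) => x [Ax _].
  have [xe|ex] := ltP (norms (x - alpha0 M)%R) e.
    have near_e : \forall x' \near x, (norms (x' - alpha0 M) < e)%R.
      have cts : {for x, continuous (fun y : par => norms (y - alpha0 M)%R)}.
        apply: (@continuous_comp _ _ _ (fun y : par => (y - alpha0 M)%R)).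
          by apply: continuousB => //; exact: cst_continuous.
        exact: continuous_norms.
      exact: (cvgr_lt _ cts).
    near=> x' c => _; rewrite leNgt => /negP; case.
    exact: (near near_e x').
  have Qx : 0 < Q x.
    rewrite lt0e Q_ge0// andbT; apply/eqP => /(Q_eq0 Ax) xa0.
    by move: ex; rewrite xa0 leNgt e0.
  have [r r0 rQ] : exists2 r : R, (0 < r)%R & r%:E < Q x.
    case: (Q x) Qx => [q|_|//]; last by exists 1%R => //; exact: ltry.
    by rewrite lte_fin => q0; exists (q / 2)%R; rewrite ?lte_fin; lra.
  case: hID => _ _ /(_ x r rQ)[V xV VQ] _.
  have {}xV : \forall y \near x, Aset y -> V y.
    by move: xV; rewrite /nbhs /= -nbhs_subspace_in.
  have c_r : \forall c \near (0%R : R)^'+, (c < r)%R by exact: nbhs_right_lt.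
  near=> x' c => Ax' _; apply: (@lt_trans _ _ r%:E).
    by rewrite lte_fin; exact: (near c_r c).
  by apply: VQ; move: Ax'; exact: (near xV x').
near ((0%R : R)^'+)%R => d; exists d.
  by near: d; exact: nbhs_right_gt.
by move=> a Aa aK ea; apply: (near Pc d _ a (conj Aa aK) Aa ea).
Unshelve. all: by end_near. Qed.

End Identification.

(** * Bound on the penalized bootstrap criterion *)

Section CriterionBound.
Variable R : realType.

(** A sequence dominating every null sequence, up to constants, is bounded away
    from zero. Otherwise the square roots of its record minima, extended by zero
    to the other indices, form a null sequence that it does not dominate. *)
Lemma dominating_null_seq (s : nat -> R) : (forall n, 0 < s n) ->
  (forall a : nat -> R, (forall n, 0 <= a n) -> a @ \oo --> (0 : R) ->
     exists C : R, \forall n \near \oo, a n <= C * s n) ->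
  exists2 c : R, 0 < c & forall n, c <= s n.
Proof.
move=> s0 sdom; apply: contrapT => nobound.
have small c : 0 < c -> exists n, s n < c.
  move=> c0; apply: contrapT => /forallNP nlt; apply: nobound; exists c => // n.
  by rewrite leNgt; exact/negP.
have prefix N : exists2 b : R, 0 < b & forall m, (m <= N)%N -> b <= s m.
  elim: N => [|N [b b0 bs]].
    by exists (s 0%N) => // m; rewrite leqn0 => /eqP ->.
  exists (Num.min b (s N.+1)); first by rewrite lt_min b0 s0.
  move=> m; rewrite leq_eqVlt => /predU1P[->|/bs bm].
    by rewrite ge_min lexx orbT.
  by rewrite ge_min bm.
pose record n := [forall m : 'I_n, s n < s m].
pose a n := if record n then Num.sqrt (s n) else 0.
have a_ge0 n : 0 <= a n by rewrite /a; case: ifP => // _; exact: sqrtr_ge0.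
have [|C] := sdom a a_ge0.
  apply/cvgrPdist_le => e e0; have [n1 sn1] := small _ (exprn_gt0 2 e0).
  near=> n; rewrite sub0r normrN ger0_norm// /a.
  case: ifP => [/forallP rn|_]; last exact: ltW.
  have n1n : (n1 < n)%N by near: n; exact: nbhs_infty_gt.
  have := rn (Ordinal n1n) => /= snn1.
  apply: (@le_trans _ _ (Num.sqrt (e ^+ 2))); last first.
    by rewrite sqrtr_sqr gtr0_norm.
  by rewrite ler_wsqrtr// ltW// (lt_trans snn1).
move=> [N _ aC]; pose C' := `|C| + 1; have [b b0 bs] := prefix N.
have C0 : 0 < C' by rewrite ltr_wpDl.
(* The first index with a value below [d] is a record: it is at least [N]
   because [d <= b], and there the square root exceeds [C'] times the value because
   [d <= C' ^- 2]. *)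
pose d := Num.min b (C' ^- 2).
have d0 : 0 < d by rewrite lt_min b0 invr_gt0 exprn_gt0.
have [n snd nmin] := ex_minnP (small _ d0).
have rn : record n.
  apply/forallP => m; apply: (lt_le_trans snd).
  rewrite leNgt; apply/negP => /nmin.
  by rewrite leqNgt ltn_ord.
have Nn : (N <= n)%N.
  rewrite leqNgt; apply/negP => /ltnW /bs; rewrite leNgt => /negP; apply.
  by move: snd; rewrite lt_min => /andP[].
have : Num.sqrt (s n) <= C' * s n.
  have := aC n Nn; rewrite /a rn => /le_trans; apply.
  rewrite ler_wpM2r ?(ltW (s0 n))// (le_trans (ler_norm C))// lerDl//.
rewrite -[in leRHS](sqr_sqrtr (ltW (s0 n))) expr2 mulrA.
rewrite -[leLHS]mul1r ler_pM2r ?sqrtr_gt0// leNgt => /negP; apply.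
have : s n * C' ^+ 2 < 1.
  rewrite -ltr_pdivlMr ?exprn_gt0// div1r.
  by move: snd; rewrite lt_min => /andP[].
rewrite -{1}(sqr_sqrtr (ltW (s0 n))) -exprMn mulrC expr_lt1// mulr_ge0//.
exact: ltW.
Unshelve. all: by end_near. Qed.

Local Open Scope ereal_scope.

Lemma abse_le_fin (x : \bar R) (y : R) : `|x| <= y%:E ->
  exists2 r : R, x = r%:E & (`|r| <= y)%R.
Proof. by case: x => [r| |]//=; rewrite lee_fin => ?; exists r. Qed.

Lemma pmule_le_fin (l x : R) (p : \bar R) : (0 < l)%R -> 0 <= p ->
  l%:E * p <= x%:E -> exists2 q : R, p = q%:E & (0 <= q)%R.
Proof.
move=> l0; case: p => [q|_|//]; first by rewrite lee_fin; exists q.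
by rewrite gt0_muley ?lte_fin// leye_eq.
Qed.

End CriterionBound.

Section Criterion.
Variables (R : realType) (M : model R) (E : experiment M) (T : procedure M).
Hypotheses (hM : model_spec M) (hF : first_stage_spec E T)
  (hT : penalized_spec T) (hEst : estimators_spec E T) (hID : ID T)
  (hPEN : PEN T) (hC1 : CRIT1 E T) (hB1 : BCRIT1 E T).
Local Notation par := ('rV[R]_(dtheta M) * Hsp M)%type.
Local Notation estimator := (forall n, sample M n -> n.-tuple R -> par).

Lemma QnB_ge0 n (z : sample M n) v (a : par) : 0 <= QnB T z v a.
Proof.
rewrite mulr_ge0// ?invr_ge0 ?ler0n// sumr_ge0// => i _.
by apply: wsq_ge0; case: hF.
Qed.

Lemma Qn_ge0 n (z : sample M n) (a : par) : 0 <= Qn T z a.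
Proof. exact: QnB_ge0. Qed.

Lemma lam_gt0 n : 0 < lam T n.
Proof. by case: hPEN => -[]. Qed.

Lemma Theta_alpha0 : Theta M (alpha0 M).1.
Proof. by case: hM => _ _ _ /interior_subset. Qed.

Lemma Ak_Pia0 n : Ak T n (Pia0 T n).
Proof.
split; first exact: Theta_alpha0.
by case: hID => _ [_ _ _ _ [+ _]] _ _; exact.
Qed.

Local Open Scope ereal_scope.

Lemma Pen_ge0 h : 0 <= Pen T h.
Proof. by case: hT. Qed.

Definition pcrit n (z : sample M n) (v : n.-tuple R) (a : par) : \bar R :=
  (QnB T z v a)%:E + (lam T n)%:E * Pen T a.2.

(** What the restricted and unrestricted bootstrap estimators have in common:
    the estimator computed from the data satisfies both constraints. *)
Definition beats_alphahat (est : estimator) : Prop :=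
  (forall n z v, Ak T n (est n z v)) /\
  exists2 r : bstat M, oPV E (invn R) r & forall n z v,
    pcrit z v (est n z v) <= pcrit z v (alphahat T z) + r n z v.

Lemma alphahat_Ak n (z : sample M n) : Ak T n (alphahat T z).
Proof. by case: hEst => -[r _ /(_ n z)[]]. Qed.

Lemma approx_min_le n c S r (a b : par) : approx_min T n c S r a -> S b ->
  (c a)%:E + (lam T n)%:E * Pen T a.2 <=
  (c b)%:E + (lam T n)%:E * Pen T b.2 + r.
Proof.
move=> [_ /le_trans + Sb]; apply.
by rewrite leeD2r// ereal_inf_lbound//; exists b.
Qed.

Lemma alphaB_beats : beats_alphahat (@alphaB R M T).
Proof.
case: hEst => _ [r r0 hr] _; split=> [n z v|]; first by case: (hr n z v).
by exists r => // n z v; apply: approx_min_le (hr n z v) _; exact: alphahat_Ak.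
Qed.

Lemma alphaRB_beats : beats_alphahat (@alphaRB R M T).
Proof.
case: hEst => _ _ [r r0 hr]; split=> [n z v|]; first by case: (hr n z v) => -[].
exists r => // n z v; apply: approx_min_le (hr n z v) _.
by split => //; exact: alphahat_Ak.
Qed.

(** The null sequences [r] in the condition on the penalty level are arbitrary,
    which forces [1/n] itself to be of the order of [lam]. *)
Lemma inv_n_le_lam : exists C : R, \forall n \near \oo,
  (inv_n R n <= C * lam T n)%R.
Proof.
(* [maxn n 1] keeps the sequence positive at the index zero. *)
have [||c c0 lamc] :=
  @dominating_null_seq _ (fun n => lam T n * (maxn n 1)%:R)%R.
- by move=> n; rewrite mulr_gt0 ?lam_gt0// ltr0n leq_max orbT.
- move=> a a0 acvg; case: hPEN => -[_ /(_ (fun n => a n / n%:R)%R)] + _ _ _.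
  case=> [|C HC].
    apply: cvg_trans acvg; apply: near_eq_cvg; near=> n.
    by rewrite divfK// pnatr_eq0 -lt0n; near: n; exact: nbhs_infty_gt.
  exists C; near=> n; have n0 : (0 < n)%N by near: n; exact: nbhs_infty_gt.
  rewrite (maxn_idPl _)// mulrA -ler_pdivrMr ?ltr0n// -lee_fin.
  have : `|Q (Pia0 T n) + (a n / n%:R)%:E| <= (C * lam T n)%:E by near: n.
  apply: le_trans; apply: le_trans (lee_abs _); rewrite leeDr//.
  by apply: Q_ge0 => //; exact: Theta_alpha0.
- exists (c^-1)%R; near=> n.
  have n0 : (0 < n)%N by near: n; exact: nbhs_infty_gt.
  have := lamc n; rewrite (maxn_idPl _)// => cn.
  rewrite /inv_n -div1r ler_pdivrMr ?ltr0n// -mulrA mulrC.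
  by rewrite ler_pdivlMr// mul1r.
Unshelve. all: by end_near. Qed.

Lemma Q_Pia0_le_lam : exists C : R, \forall n \near \oo,
  Q (Pia0 T n) <= (C * lam T n)%:E.
Proof.
case: hPEN => -[_ + _] _ _ => /(_ (fun=> 0%R))[|C HC].
  rewrite /small_inv_n (_ : (fun n => _) = cst 0%R); first exact: cvg_cst.
  by apply/funext => n; rewrite mul0r.
exists C; apply: filterS HC => n; rewrite adde0; apply: le_trans.
exact: lee_abs.
Qed.

Lemma Pen_Pia0_bounded : exists2 K : R, (0 <= K)%R &
  \forall n \near \oo, Pen T (PiH T n) <= K%:E.
Proof.
case: hPEN => _ [[C HC] P0y] _.
have [p0 p00 p0E] : exists2 p : R, (0 <= p)%R & Pen T (alpha0 M).2 = p%:E.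
  have := Pen_ge0 (alpha0 M).2; case: (Pen T (alpha0 M).2) P0y => [p||]//= _.
  by rewrite lee_fin; exists p.
exists (p0 + `|C|)%R; first by rewrite addr_ge0.
apply: filterS HC => n; rewrite p0E; case: (Pen T _) => [p| |]//=.
rewrite !lee_fin => pC; rewrite -lerBlDl (le_trans (ler_norm _))//.
by rewrite (le_trans pC)// ler_norm.
Qed.

(** The argument only evaluates criteria at the two comparison points, the
    estimator computed from the data and the sieve point. No lower bound on a
    criterion enters, so [K] is independent of the cutoff [M0] to which those
    bounds are tied. *)
Lemma criterion_bound : exists2 K : R, (0 < K)%R &
  forall est, beats_alphahat est -> forall e : R, (0 < e)%R ->
    unlikely E e 0 (fun n z =>
      [set v | (K * lam T n)%:E < pcrit z v (est n z v)]).
Proof.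
have [Ci HCi] := inv_n_le_lam; have [Cq HCq] := Q_Pia0_le_lam.
have [Kp Kp0 HKp] := Pen_Pia0_bounded.
case: hC1 => c0 c00 [r1 r1o r1le]; case: hB1 => cB cB0 [rb rbo rble].
case: hEst => -[r0 r0o r0le] _ _.
(* [K1 * lam] bounds the penalized criterion of the data estimator: its terms
   come from [Q] and the penalty at the sieve point and from two remainders. *)
pose K1 := (c0 * Cq + Kp + 2 * Ci)%R.
pose K := (cB * K1 + K1 + 2 * Ci)%R.
exists (`|K| + 1)%R => [|est [_ [rB rBo rBle]] e e0]; first by rewrite ltr_wpDl.
have invn0 : \forall n \near \oo, 0 <= invn R n.
  by near=> n; rewrite lee_fin invr_ge0.
have e20 : (0 < e / 2)%R by rewrite divr_gt0.
have zU := unlikelyZU (oP_unlikely ltr01 r0o) (oP_unlikely ltr01 r1o).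
have vU := unlikelyU (oPV_unlikely e20 ltr01 invn0 rBo)
  (oPV_unlikely e20 ltr01 invn0 rbo).
have := unlikelyU (unlikelyZW (lexx 0%R) zU) vU.
rewrite !addr0 add0r -splitr; apply: sub_unlikely.
near=> n => z v /=; apply: contraPP.
rewrite !mul1e => /not_orP[/not_orP[/negP + /negP +] /not_orP[/negP + /negP +]].
rewrite -!leNgt => /abse_le_fin[s0 s0E s0n] /abse_le_fin[s1 s1E s1n].
move=> /abse_le_fin[sB sBE sBn] /abse_le_fin[sb sbE sbn].
apply/negP; rewrite -leNgt.
have l0 := lam_gt0 n.
have Cin : (inv_n R n <= Ci * lam T n)%R by near: n.
have [q qE q0] : exists2 q : R, Q (Pia0 T n) = q%:E & (q <= Cq * lam T n)%R.
  have : Q (Pia0 T n) <= (Cq * lam T n)%:E by near: n.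
  have : 0 <= Q (Pia0 T n) by apply: Q_ge0 => //; exact: Theta_alpha0.
  by case: (Q _) => [q| |]//; rewrite !lee_fin => _; exists q.
have [p pE /andP[p0 pK]] :
    exists2 p : R, Pen T (PiH T n) = p%:E & (0 <= p <= Kp)%R.
  have : Pen T (PiH T n) <= Kp%:E by near: n.
  have := Pen_ge0 (PiH T n); case: (Pen T _) => [p| |]//.
  by rewrite !lee_fin => p0 pK; exists p; rewrite ?p0.
have HA := approx_min_le (r0le n z) (Ak_Pia0 n).
rewrite pE s0E -EFinM -!EFinD in HA.
have [pa paE pa0] : exists2 q : R, Pen T (alphahat T z).2 = q%:E & (0 <= q)%R.
  apply: (pmule_le_fin l0 (Pen_ge0 _) (le_trans _ HA)).
  by rewrite leeDr// lee_fin Qn_ge0.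
rewrite paE -EFinM -EFinD lee_fin in HA.
have HQ := r1le n z; rewrite qE s1E -EFinM -EFinD lee_fin in HQ.
have Hb := rble n z v; rewrite sbE -EFinD lee_fin in Hb.
apply: (le_trans (rBle n z v)); rewrite /pcrit paE sBE -EFinM -!EFinD lee_fin.
have qa0 : (0 <= Qn T z (alphahat T z))%R by exact: Qn_ge0.
have lpa0 : (0 <= lam T n * pa)%R by rewrite mulr_ge0// ltW.
have c0q : (c0 * q <= c0 * (Cq * lam T n))%R by rewrite ler_pM2l.
have lp : (lam T n * p <= lam T n * Kp)%R by rewrite ler_pM2l.
have {s0n} := ler_normlW s0n; have {s1n} := ler_normlW s1n.
have {sBn} := ler_normlW sBn; have {sbn} := ler_normlW sbn => sbn sBn s1n s0n.
have HK1 : (Qn T z (alphahat T z) + lam T n * pa <= K1 * lam T n)%R.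
  by rewrite /K1; lra.
have cQ : (cB * Qn T z (alphahat T z) <= cB * (K1 * lam T n))%R.
  by rewrite ler_pM2l//; lra.
have : (K * lam T n <= `|K| * lam T n)%R.
  by rewrite ler_wpM2r ?(ltW l0)// ler_norm.
by rewrite /K; lra.
Unshelve. all: by end_near. Qed.

End Criterion.

(** * Consistency *)

Section Consistency.
Variables (R : realType) (M : model R) (E : experiment M) (T : procedure M).
Hypotheses (hM : model_spec M) (hF : first_stage_spec E T)
  (hT : penalized_spec T) (hID : ID T) (hPEN : PEN T).
Local Notation par := ('rV[R]_(dtheta M) * Hsp M)%type.
Local Open Scope ereal_scope.

Variables (K : R) (est : forall n, sample M n -> n.-tuple R -> par).
Hypothesis est_Ak : forall n (z : sample M n) v, Ak T n (est z v).
Hypothesis est_crit : forall e : R, (0 < e)%R -> unlikely E e 0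
  (fun n z => [set v | (K * lam T n)%:E < pcrit T z v (est z v)]).

Lemma pcrit_le n (z : sample M n) v a : pcrit T z v a <= (K * lam T n)%:E ->
  (QnB T z v a <= K * lam T n)%R /\ Pen T a.2 <= K%:E.
Proof.
have l0 := lam_gt0 hPEN n; have p0 := Pen_ge0 hT a.2.
have qB0 := QnB_ge0 hF z v a.
move=> h; have [q qE q0] : exists2 q : R, Pen T a.2 = q%:E & (0 <= q)%R.
  by apply: (pmule_le_fin l0 p0 (le_trans _ h)); rewrite leeDr// lee_fin.
have lq : (0 <= lam T n * q)%R by rewrite mulr_ge0// ltW.
move: h; rewrite /pcrit qE -EFinM -EFinD lee_fin => h; split; first lra.
by rewrite lee_fin -(ler_pM2l l0) [leRHS]mulrC; lra.
Qed.

Lemma OPV_Pen : (0 < K)%R -> OPV E (cst 1) (fun n z v => Pen T (est z v).2).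
Proof.
move=> K0 e e0; exists K => //; apply/unlikelyZ_cvg.
apply: sub_unlikely (est_crit e0); near=> n => z v /=.
rewrite mule1 gee0_abs ?(Pen_ge0 hT)//; apply: contraPP => /negP.
by rewrite -leNgt => /pcrit_le[_ h]; apply/negP; rewrite -leNgt.
Unshelve. all: by end_near. Qed.

Lemma Q_le_of_bounds (c cB x y l : R) n (z : sample M n) v a (r rB : \bar R) :
  (0 < c)%R -> (0 < cB)%R -> Aset a ->
  c%:E * Q a - r <= (Qn T z a)%:E ->
  (cB * Qn T z a)%:E - rB <= (QnB T z v a)%:E -> (QnB T z v a <= l)%R ->
  `|r| <= x%:E -> `|rB| <= y%:E ->
  Q a <= (((l + y) / cB + x) / c)%:E.
Proof.
move=> c0 cB0 Aa hQ hQB ql /abse_le_fin[s rE sx] /abse_le_fin[t rBE ty].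
move: hQ hQB; rewrite rE rBE; have := Q_ge0 hM Aa.
case: (Q a) => [q| |]//; last by rewrite gt0_muley.
rewrite -EFinM -!EFinB !lee_fin => _ qle qBle.
have sx' := ler_normlW sx; have ty' := ler_normlW ty.
rewrite ler_pdivlMr// -lerBlDr ler_pdivlMr//.
have : (cB * (c * q - s) <= cB * Qn T z a)%R by rewrite ler_pM2l.
have : (cB * s <= cB * x)%R by rewrite ler_pM2l.
lra.
Qed.

Lemma norms_unlikely (dbar dbars : nat -> R) (M0 : R) :
  dbar @ \oo --> (0 : R)%R -> dbars @ \oo --> (0 : R)%R -> (K <= M0)%R ->
  CRIT2 E T dbar M0 -> BCRIT2 E T dbars M0 ->
  forall eps e : R, (0 < eps)%R -> (0 < e)%R -> unlikely E e 0
    (fun n z => [set v | (eps <= norms (est z v - alpha0 M))%R]).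
Proof.
move=> dbar0 dbars0 KM [c c0 [r rO rle]] [cB cB0 [rB rBO rBle]] eps e eps0 e0.
have [q q0 Qq] := Q_separated hM hID hPEN K eps0.
have e20 : (0 < e / 2)%R by rewrite divr_gt0.
have e40 : (0 < e / 2 / 2)%R by rewrite divr_gt0.
(* Each of the two remainders and the penalty level contributes at most
   [c * q / 4] to [c * Q], so [Q] stays below [q]. *)
have x0 : (0 < c * q / 4)%R by rewrite divr_gt0// mulr_gt0.
have y0 : (0 < cB * (c * q) / 4)%R by rewrite divr_gt0// !mulr_gt0.
have := unlikelyU (est_crit e20) (unlikelyU
  (OPV_sq_unlikely e40 y0 dbars0 rBO)
  (unlikelyZW (ltW e40) (OP_sq_unlikely x0 dbar0 rO))).
rewrite !addr0 -!splitr; apply: sub_unlikely.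
have laml : (fun n => K * lam T n)%R @ \oo --> (0 : R)%R.
  by rewrite -(mulr0 K); apply: cvgMr; case: hT.
near=> n => z v /=; apply: contraPP.
move=> /not_orP[/negP + /not_orP[/negP + /negP +]].
rewrite -!leNgt => /pcrit_le[QBl PK] rBy rx; apply/negP; rewrite -ltNge.
rewrite ltNge; apply/negP => /(Qq _ (est_Ak z v).1 PK).
have Sa : AkM T M0 n (est z v).
  split => //=; rewrite EFinM lee_wpmul2l//.
    by rewrite lee_fin ltW// (lam_gt0 hPEN).
  by rewrite (le_trans PK)// lee_fin.
have := Q_le_of_bounds c0 cB0 (est_Ak z v).1 (rle _ _ _ Sa) (rBle _ _ v _ Sa)
  QBl rx rBy.
have ly : (K * lam T n <= cB * (c * q) / 4)%R.
  by apply: ltW; near: n; exact: (cvgr_lt _ laml).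
move=> /[swap] /lt_le_trans /[apply]; rewrite lte_fin.
apply/negP; rewrite -leNgt ler_pdivrMr// -lerBrDr ler_pdivrMr//.
lra.
Unshelve. all: by end_near. Qed.

Lemma consistency (dbar dbars : nat -> R) (M0 : R) : (0 < K)%R ->
  dbar @ \oo --> (0 : R)%R -> dbars @ \oo --> (0 : R)%R -> (K <= M0)%R ->
  CRIT2 E T dbar M0 -> BCRIT2 E T dbars M0 -> consistent E T (@est).
Proof.
move=> K0 dbar0 dbars0 KM hC2 hB2; split; last exact: OPV_Pen.
move=> e e0; apply/unlikelyZ_cvg.
apply: sub_unlikely (norms_unlikely dbar0 dbars0 KM hC2 hB2 e0 e0).
by near=> n => z v /=; rewrite mule1 lte_fin ger0_norm ?norms_ge0// => /ltW.
Unshelve. all: by end_near. Qed.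

End Consistency.

(** * Weighted norm and ill-posedness near the truth *)

Section LocalGeometry.
Variables (R : realType) (M : model R) (T : procedure M).
Local Notation par := ('rV[R]_(dtheta M) * Hsp M)%type.
Variables (bigO : (nat -> \bar R) -> dstat M -> Prop) (del : nat -> R).
Variables (Aos : set par) (M0 : R).
Hypotheses (hM : model_spec M) (hT : penalized_spec T) (hID : ID T)
  (hPEN : PEN T) (hL : LOC T bigO del Aos) (hA : local_nbhd T M0 Aos).
Hypotheses (del_gt0 : forall n, 0 < del n) (del_cvg0 : del @ \oo --> (0 : R)).
Hypotheses (M0_gt0 : 0 < M0) (Pen_alpha0 : (Pen T (alpha0 M).2 < M0%:E)%E)
  (Pen_Pia0 : (\forall n \near \oo, Pen T (PiH T n) < M0%:E)%E).
Local Open Scope ereal_scope.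

Lemma Aset_Aos (a : par) : Aos a -> Aset a.
Proof. by case: hA => AosL _ _ /AosL[]. Qed.

Lemma local_setP (a : par) : Aset a -> (norms (a - alpha0 M) < M0)%R ->
  Pen T a.2 < M0%:E -> local_set T M0 a.
Proof.
move=> Aa am aP; split => // n.
by rewrite EFinM lte_pmul2l// lte_fin (lam_gt0 hPEN).
Qed.

Lemma Aos_alpha0 : Aos (alpha0 M).
Proof.
case: hA => _ _ /nbhs_singleton; apply; apply: local_setP => //.
  exact: Theta_alpha0.
by rewrite /norms subrr /= enorm0 normr0 addr0.
Qed.

Lemma ler_coord_enorm d (u : 'rV[R]_d) j : (`|u ord0 j| <= enorm u)%R.
Proof.
rewrite -sqrtr_sqr ler_wsqrtr// (bigD1 j)//= lerDl.
by rewrite sumr_ge0// => i _; exact: sqr_ge0.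
Qed.

Lemma Aos_near : exists2 e : R, (0 < e)%R & forall a : par,
  Aset a -> (norms (a - alpha0 M) < e)%R -> Pen T a.2 < M0%:E -> Aos a.
Proof.
case: hA => _ _; rewrite /within/= => /nbhs_ballP[e /= e0 He].
exists (Num.min e M0); first by rewrite lt_min M0_gt0 andbT.
move=> a Aa; rewrite lt_min => /andP[ae aM] aP.
apply: (He a); last exact: local_setP.
split=> /=.
  split=> //.
  move=> i j; rewrite /ball /= (ord1 i) distrC; apply: le_lt_trans ae.
  apply: (@le_trans _ _ (enorm (a - alpha0 M)%R.1)).
    by apply: le_trans (ler_coord_enorm _ j); rewrite !mxE.
  by rewrite lerDl.
rewrite -ball_normE /ball_/= distrC; apply: le_lt_trans ae.
by rewrite lerDr enorm_ge0.
Qed.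

Lemma norms_Pia0_cvg :
  (fun n => norms (Pia0 T n - alpha0 M)%R) @ \oo --> (0 : R)%R.
Proof.
case: hID => _ [_ _ _ _ [_ PiH0]] _ _.
rewrite (_ : (fun n => _) = (fun n => `|PiH T n - (alpha0 M).2|%R))//.
by apply/funext => n; rewrite /norms /= subrr enorm0 add0r.
Qed.

Lemma Aosn_Pia0 : \forall n \near \oo, Aosn T Aos n (Pia0 T n).
Proof.
have [e e0 He] := Aos_near.
near=> n; split; last exact: Ak_Pia0.
apply: He; first exact: Theta_alpha0.
  by near: n; exact: (cvgr_lt _ norms_Pia0_cvg).
by near: n; exact: Pen_Pia0.
Unshelve. all: by end_near. Qed.

(** The square of [normw] on [directions Aos]; unlike [normw] it involves no
    root, and the quasi-triangle inequality [Nw_lin_le] is an inequality of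
    integrals. *)
Definition Nw (v : par) : \bar R :=
  wint (lawZ M) (fun z => Sigma M z.2) (fun z => mdot z.2 v).

Local Notation V := (directions Aos).

Lemma directions_sub (a b : par) : Aos a -> Aos b -> V (a - b)%R.
Proof. by move=> Aa Ab; exists 1%R, a, b; rewrite scale1r. Qed.

Lemma directionsZ (s : R) (v : par) : V v -> V (s *: v)%R.
Proof.
by move=> [t [a [b [Aa Ab ->]]]]; exists (s * t)%R, a, b; rewrite scalerA.
Qed.

Lemma mrow_mdot (v : par) : V v ->
  mrow (fun z : obs R (dY M) (dX M) => mdot z.2 v).
Proof.
case: hL => -[[mV _] _] _ _ _ Vv j.
exact: measurableT_comp (mV v j Vv) measurable_snd.
Qed.

Lemma Nw_ge0 (v : par) : V v -> 0 <= Nw v.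
Proof.
move=> /mrow_mdot.
exact: (wint_ge0 (measurable_Sigma hM) (ae_posdef_Sigma hM)).
Qed.

(** The pathwise derivative at the true parameter is almost surely linear, so
    the pointwise inequality for quadratic forms integrates. *)
Lemma Nw_lin_le (s : R) (u v w : par) : V u -> V v -> V w ->
  w = (s *: u + v)%R -> Nw w <= (2 * s ^+ 2)%:E * Nw u + 2%:E * Nw v.
Proof.
move=> Vu Vv Vw wE.
apply: (wint_lin_le (measurable_Sigma hM) (ae_posdef_Sigma hM));
  [exact: mrow_mdot..|].
case: hL => -[[_ dV] _] _ _ _; apply: filterS dV => z /(_ (alpha0 M)) [].
  by split; [exact: Aos_alpha0|case: hM].
by move=> _ /(_ s u v Vu Vv) + _; rewrite wE.
Qed.

Lemma normwE (v : par) : normw v = Nw v `^ 2^-1.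
Proof. by []. Qed.

Lemma normw_sqr (v : par) : V v -> normw v ^+ 2 = Nw v.
Proof.
move=> /Nw_ge0; rewrite normwE expe2.
case: (Nw v) => [r|_|//]; last by rewrite /= gt_eqF// mulyy.
rewrite lee_fin => r0.
by rewrite poweR_EFin powR12_sqrt// -EFinM -expr2 sqr_sqrtr.
Qed.

Lemma normw_eq0 (v : par) : V v -> (normw v == 0) = (Nw v == 0).
Proof.
by move=> /Nw_ge0 N0; rewrite normwE poweR_eq0// invr_eq0 pnatr_eq0 andbT.
Qed.

Lemma normw_le (v : par) (x : R) : V v -> (0 <= x)%R ->
  Nw v <= (x ^+ 2)%:E -> normw v <= x%:E.
Proof.
move=> /Nw_ge0; rewrite normwE; case: (Nw v) => [r||]//.
rewrite !lee_fin => r0 x0 rx; rewrite powR12_sqrt//.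
by rewrite -[leRHS](ger0_norm x0) -sqrtr_sqr ler_wsqrtr.
Qed.

Lemma Nw_fin (a : par) : Aos a -> exists r : R, Nw (a - alpha0 M)%R = r%:E.
Proof.
move=> Aa; have := Nw_ge0 (directions_sub Aa Aos_alpha0).
case: hL => -[_ [C HC]] _ _ _; have := HC a Aa; rewrite normwE.
by case: (Nw _) => [r|/=|//]; [exists r|rewrite gt_eqF].
Qed.

Lemma Nw_null (s : R) (u v w : par) : V u -> V v -> V w ->
  w = (s *: u + v)%R -> Nw u = 0 -> Nw v = 0 -> Nw w = 0.
Proof.
move=> Vu Vv Vw wE u0 v0; apply/eqP; rewrite eq_le Nw_ge0// andbT.
by have := Nw_lin_le Vu Vv Vw wE; rewrite u0 v0 !mule0 adde0.
Qed.

Lemma Q_equiv : exists c1 c2 : R, (0 < c1)%R /\ forall a : par, Aos a ->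
  c1%:E * Nw (a - alpha0 M)%R <= Q a <= c2%:E * Nw (a - alpha0 M)%R.
Proof.
case: hL => _ [c1 [c2 [/andP[c10 _] HQ]]] _ _; exists c1, c2; split => // a Aa.
by rewrite -normw_sqr ?HQ//; exact: directions_sub Aos_alpha0.
Qed.

Lemma del_dominates : \forall n \near \oo,
  Q (Pia0 T n) <= sq del n /\ (lam T n <= del n ^+ 2)%R.
Proof.
case: hL => _ _ _ /(_ (fun=> 0%R))[|N _ HN].
  rewrite /small_inv_n (_ : (fun n => _) = cst 0%R); first exact: cvg_cst.
  by apply/funext => n; rewrite mul0r.
exists N => // n /HN HNn; split; first by rewrite -HNn !le_max lexx orbT.
by rewrite -lee_fin -[leRHS]/(sq del n) -HNn !le_max lexx !orbT.
Qed.

Lemma Nw_Pia0_le : exists2 C : R, (0 < C)%R & \forall n \near \oo,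
  Nw (Pia0 T n - alpha0 M)%R <= (C * del n ^+ 2)%:E.
Proof.
have [c1 [c2 [c10 HQ]]] := Q_equiv.
exists (c1^-1)%R; first by rewrite invr_gt0.
near=> n; have [Ap _] : Aosn T Aos n (Pia0 T n) by near: n; exact: Aosn_Pia0.
have [Qd _] : Q (Pia0 T n) <= sq del n /\ (lam T n <= del n ^+ 2)%R.
  by near: n; exact: del_dominates.
have /andP[+ _] := HQ _ Ap; move=> /le_trans/(_ Qd); rewrite /sq.
have := Nw_ge0 (directions_sub Ap Aos_alpha0).
case: (Nw _) => [r|_|//]; last by rewrite gt0_muley ?lte_fin.
by rewrite -EFinM !lee_fin => _; rewrite ler_pdivlMl.
Unshelve. all: by end_near. Qed.

Lemma Aosn_mono m n : (kn T m <= kn T n)%N -> Aosn T Aos m `<=` Aosn T Aos n.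
Proof.
move=> mn a [Aa [Ta Ha]]; split => //; split => //.
case: hID => _ [_ _ [Hmono _ _] _ _] _ _.
have Hmon : {homo @Hk R M T : i j / (i <= j)%N >-> i `<=` j}.
  apply: (homo_leq (r := fun A B : set (Hsp M) => A `<=` B)) => //.
    exact: subset_refl.
  by move=> B A C; exact: subset_trans.
exact: Hmon mn _ Ha.
Qed.

Lemma Aosn_segment n (a c : par) (t : R) : (0 <= t <= 1)%R ->
  Aosn T Aos n a -> Aosn T Aos n c -> Aosn T Aos n (a + t *: (c - a))%R.
Proof.
move=> /andP[t0 t1] [Aa [_ [b1 a2E]]] [Ac [_ [b2 c2E]]].
have At : Aos (a + t *: (c - a))%R.
  case: hA => _ /(_ c a (Itv01 t0 t1)) + _; rewrite !inE => /(_ Ac Aa).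
  rewrite /conv /= /unstable.onem scalerBl scale1r; congr (Aos _).
  by rewrite scalerBr addrCA.
split => //; split; first exact: Aset_Aos At.
exists (fun j => b1 j + t * (b2 j - b1 j))%R.
rewrite /= a2E c2E -sumrB scaler_sumr -big_split /=; apply: eq_bigr => j _.
by rewrite scalerDl -scalerA scalerBl.
Qed.

(** When [a] differs from the sieve point without being separated from it by the
    weighted norm, but some [c] is separated, the points close to [a] on the
    segment from [a] to [c] make the ratio defining [tau] unbounded. *)
Lemma tau_pinfty n (a c : par) :
  Aosn T Aos n (Pia0 T n) -> Aosn T Aos n a -> Aosn T Aos n c ->
  Nw (a - Pia0 T n)%R = 0 -> norms (a - Pia0 T n)%R != 0%R ->
  Nw (c - Pia0 T n)%R != 0 -> tau T Aos n = +oo.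
Proof.
move=> Ap Aa Ac a0 aneq cneq; set p := Pia0 T n in Ap a0 aneq cneq *.
have Va := directions_sub Aa.1 Ap.1.
have Vca := directions_sub Ac.1 Aa.1.
have Vcp := directions_sub Ac.1 Ap.1.
have A0 : (0 < norms (a - p))%R by rewrite lt0r aneq norms_ge0.
have [B BE B0] : exists2 B : R, Nw (c - a)%R = B%:E & (0 <= B)%R.
  have := Nw_ge0 Vca; have : Nw (c - a)%R < +oo.
    have [ra raE] := Nw_fin Aa.1; have [rc rcE] := Nw_fin Ac.1.
    have VaA := directions_sub Aa.1 Aos_alpha0.
    have VcA := directions_sub Ac.1 Aos_alpha0.
    apply: le_lt_trans (Nw_lin_le (s := (-1)%R) VaA VcA Vca _) _.
      by rewrite scaleN1r opprB [RHS]addrC subrKA.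
    by rewrite raE rcE -!EFinM -EFinD ltry.
  by case: (Nw _) => [B| |]//; rewrite lee_fin => _; exists B.
(* On the segment at parameter [t] the weighted distance is at most
   [t * Num.sqrt (2 * B)], and for small [t] the strong distance is at least
   half of that at [a]; [t] is then so small that the ratio exceeds [G]. *)
apply: eq_infty => G; pose D := (`|G| * Num.sqrt (2 * B) + 1)%R.
have D0 : (0 < D)%R by rewrite ltr_wpDl// mulr_ge0// sqrtr_ge0.
have cts : {for (0%R : R), continuous
    (fun t : R => norms (t *: (c - a) + (a - p))%R)}.
  apply: (@continuous_comp _ _ _ (fun t : R => (t *: (c - a) + (a - p))%R)).
    apply: (@continuousD _ _ _ (fun t : R => (t *: (c - a))%R)).
      exact: (@scalel_continuous _ _ (c - a)%R).
    exact: cst_continuous.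
  exact: continuous_norms.
have near_A : \forall t \near (0%R : R)^'+,
    (norms (a - p) / 2 < norms (t *: (c - a) + (a - p)))%R.
  apply: (cvgr_gt _ (cvg_at_right_filter cts)).
  by rewrite scale0r add0r; lra.
near ((0%R : R)^'+)%R => t.
have t0 : (0 < t)%R by near: t; exact: nbhs_right_gt.
have t1 : (t <= 1)%R by near: t; exact: nbhs_right_le.
have tD : (t < norms (a - p) / 2 / D)%R.
  by near: t; apply: nbhs_right_lt; rewrite !divr_gt0.
have tA : (norms (a - p) / 2 < norms (t *: (c - a) + (a - p)))%R.
  exact: (near near_A t).
pose ct := (a + t *: (c - a))%R.
have Act : Aosn T Aos n ct by apply: Aosn_segment => //; rewrite (ltW t0).
have ctE : (ct - p)%R = (t *: (c - a) + (a - p))%R by rewrite /ct addrAC addrC.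
have Vct := directions_sub Act.1 Ap.1.
have Nct : Nw (ct - p)%R <= ((t * Num.sqrt (2 * B)) ^+ 2)%:E.
  have := Nw_lin_le Vca Va Vct ctE.
  rewrite a0 mule0 adde0 BE -EFinM exprMn sqr_sqrtr ?mulr_ge0//.
  move=> /le_trans; apply.
  by rewrite lee_fin [(2 * t ^+ 2)%R]mulrC mulrA.
have ct_neq : Nw (ct - p)%R != 0.
  apply: contra_neq cneq => ct0.
  have e1 : ((1 - t^-1) *: (a - p) = (- t^-1) *: (a - p) + (a - p))%R.
    by rewrite scalerBl scale1r scaleNr addrC.
  have n1 := Nw_null Va Va (directionsZ _ Va) e1 a0 a0.
  have e2 : (c - p = t^-1 *: (ct - p) + (1 - t^-1) *: (a - p))%R.
    rewrite ctE scalerDr scalerA mulVf ?gt_eqF// scale1r scalerBl scale1r.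
    by rewrite -addrA [(t^-1 *: _ + _)%R]addrC subrK subrKA.
  exact: Nw_null Vct (directionsZ _ Va) Vcp e2 ct0 n1.
have y0 : (0 <= t * Num.sqrt (2 * B))%R by rewrite mulr_ge0 ?sqrtr_ge0// ltW.
have := normw_le Vct y0 Nct; move: ct_neq; rewrite -normw_eq0//.
have := poweR_ge0 (Nw (ct - p)%R) 2^-1; rewrite -normwE => w0 w_neq w_le.
have [w wE [{}w0 {}w_le]] : exists2 w : R, normw (ct - p)%R = w%:E &
    (0 < w)%R /\ (w <= t * Num.sqrt (2 * B))%R.
  case: (normw _) w0 w_neq w_le => [w| |]//; rewrite !lee_fin => w0 w_neq w_le.
  by exists w => //; split => //; rewrite lt0r w0 andbT.
apply: le_trans (ereal_sup_ubound _); last first.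
  by right; exists ct => //; split => //=; rewrite -/p wE gt_eqF ?lte_fin.
rewrite -/p wE inver gt_eqF// -EFinM lee_fin ler_pdivlMr// ctE.
move: tD; rewrite ltr_pdivlMr// /D => tD.
have : (G * w <= `|G| * (t * Num.sqrt (2 * B)))%R.
  apply: (@le_trans _ _ (`|G| * w)%R).
    by rewrite ler_wpM2r ?ler_norm// ltW.
  by rewrite ler_wpM2l.
lra.
Unshelve. all: by end_near. Qed.

Lemma tau_ge0 n : 0 <= tau T Aos n.
Proof. by apply: ereal_sup_ubound; left. Qed.

Lemma kn_ge k : \forall n \near \oo, (k <= kn T n)%N.
Proof. by case: hT => + _ _ _ => /cvgnyPge. Qed.

(** Without separation a local sieve point is at the same weighted distance from
    the truth, up to a factor, as all later sieve approximations, which converge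
    to the truth. The distance is therefore zero, and so is [Q]. *)
Lemma unseparated_trivial :
  (forall m (c c' : par), Aosn T Aos m c -> Aosn T Aos m c' ->
     Nw (c - c')%R = 0) ->
  forall n (a : par), Aosn T Aos n a -> norms (a - alpha0 M)%R = 0%R.
Proof.
move=> sep n a Aa.
have Va := directions_sub Aa.1 Aos_alpha0.
have [C C0 HC] := Nw_Pia0_le.
have d2 := cvg_mul_sqr C del_cvg0.
have Na0 : Nw (a - alpha0 M)%R = 0.
  apply/eqP; rewrite eq_le Nw_ge0// andbT; apply/lee_addgt0Pr => e e0.
  rewrite add0e; near \oo => m.
  have Ap : Aosn T Aos m (Pia0 T m) by near: m; exact: Aosn_Pia0.
  have Am : Aosn T Aos m a.
    by apply: Aosn_mono Aa; near: m; exact: kn_ge.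
  have Vpa := directions_sub Ap.1 Aos_alpha0.
  have Vap := directions_sub Am.1 Ap.1.
  have aE : (a - alpha0 M = 1 *: (a - Pia0 T m) + (Pia0 T m - alpha0 M))%R.
    by rewrite scale1r subrKA.
  have := Nw_lin_le Vap Vpa Va aE; rewrite (sep _ _ _ Am Ap) mule0 add0e.
  move=> /le_trans; apply.
  apply: (@le_trans _ _ (2%:E * (C * del m ^+ 2)%:E)).
    by rewrite lee_wpmul2l//; near: m.
  rewrite -EFinM lee_fin -ler_pdivlMl//.
  apply: ltW; near: m; apply: (cvgr_lt _ d2).
  by rewrite mulr_gt0// invr_gt0.
have [c1 [c2 [c10 HQ]]] := Q_equiv.
apply: (Q_eq0 hM hID) (Aset_Aos Aa.1) _; apply/eqP.
rewrite eq_le (Q_ge0 hM (Aset_Aos Aa.1)) andbT.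
by have /andP[_] := HQ a Aa.1; rewrite Na0 mule0.
Unshelve. all: by end_near. Qed.

(** This covers the points that the supremum defining [tau] leaves out. If two
    local sieve points are separated at some stage, both remain available later,
    since the sieve spaces grow, and one of them is separated from the current
    sieve approximation. *)
Lemma null_trichotomy : \forall n \near \oo, forall a : par,
  Aosn T Aos n a -> Nw (a - Pia0 T n)%R = 0 ->
  [\/ norms (a - alpha0 M)%R = 0%R, norms (a - Pia0 T n)%R = 0%R |
      tau T Aos n = +oo].
Proof.
have [[m [c [c' [Ac Ac' cc']]]]|sep] := pselect (exists m (c c' : par),
    [/\ Aosn T Aos m c, Aosn T Aos m c' & Nw (c - c')%R != 0]); last first.
  near=> n => a Aa _; apply: Or31.
  apply: unseparated_trivial Aa => m c c' Ac Ac'.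
  by apply/eqP; apply: contrapT => /negP cc'; apply: sep; exists m, c, c'.
near=> n => a Aa a0.
have Ap : Aosn T Aos n (Pia0 T n) by near: n; exact: Aosn_Pia0.
have mn : (kn T m <= kn T n)%N by near: n; exact: kn_ge.
have [|aneq] := eqVneq (norms (a - Pia0 T n)%R) 0%R; first exact: Or32.
apply: Or33; have {}Ac := Aosn_mono mn Ac; have {}Ac' := Aosn_mono mn Ac'.
have Vc := directions_sub Ac.1 Ap.1; have Vc' := directions_sub Ac'.1 Ap.1.
have [c0|] := eqVneq (Nw (c - Pia0 T n)%R) 0;
  last exact: tau_pinfty Ap Aa Ac a0 aneq.
have [c'0|] := eqVneq (Nw (c' - Pia0 T n)%R) 0;
  last exact: tau_pinfty Ap Aa Ac' a0 aneq.
have ccE : (c - c' = (-1) *: (c' - Pia0 T n) + (c - Pia0 T n))%R.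
  by rewrite scaleN1r opprB [RHS]addrC subrKA.
have := Nw_null Vc' Vc (directions_sub Ac.1 Ac'.1) ccE c'0 c0.
by move/eqP; rewrite (negbTE cc').
Unshelve. all: by end_near. Qed.

Lemma norms_le_tau n (a : par) (x : R) :
  Aosn T Aos n a -> Aosn T Aos n (Pia0 T n) ->
  Nw (a - Pia0 T n)%R != 0 -> normw (a - Pia0 T n)%R <= x%:E ->
  (norms (a - Pia0 T n)%R)%:E <= tau T Aos n * x%:E.
Proof.
move=> Aa Ap; have Va := directions_sub Aa.1 Ap.1; rewrite -normw_eq0//.
have := poweR_ge0 (Nw (a - Pia0 T n)%R) 2^-1; rewrite -normwE => w0 w_neq w_le.
have : (norms (a - Pia0 T n)%R)%:E / normw (a - Pia0 T n)%R <= tau T Aos n.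
  by apply: ereal_sup_ubound; right; exists a.
case: (normw _) w0 w_neq w_le => [w| |]//; rewrite !lee_fin => w0 w_neq w_le.
have {w_neq}wgt0 : (0 < w)%R by rewrite lt0r w0 andbT.
rewrite inver gt_eqF// lee_pdivrMr// => /le_trans; apply.
by rewrite lee_wpmul2l ?tau_ge0// lee_fin.
Qed.

Lemma norms_le_rate (C : R) : (0 < C)%R -> exists2 C' : R, (0 < C')%R &
  \forall n \near \oo, forall a : par, Aosn T Aos n a ->
    normw (a - alpha0 M)%R <= (C * del n)%:E ->
    (norms (a - alpha0 M)%R)%:E <=
      C'%:E * ((norms (Pia0 T n - alpha0 M)%R)%:E + tau T Aos n * (del n)%:E).
Proof.
move=> C0; have [B B0 HB] := Nw_Pia0_le.
(* The quasi-triangle inequality through the truth makes [D * del n] a bound on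
   the weighted distance to the sieve point. *)
pose D := Num.sqrt (2 * B + 2 * C ^+ 2).
have D2 : (D ^+ 2 = 2 * B + 2 * C ^+ 2)%R.
  by rewrite sqr_sqrtr// addr_ge0// mulr_ge0// ?sqr_ge0// ltW.
have D0 : (0 <= D)%R by exact: sqrtr_ge0.
exists (1 + D)%R; first by rewrite ltr_pwDl.
near=> n => a Aa a_le.
have Ap : Aosn T Aos n (Pia0 T n) by near: n; exact: Aosn_Pia0.
have p_le : Nw (Pia0 T n - alpha0 M)%R <= (B * del n ^+ 2)%:E by near: n.
have d0 : (0 <= del n)%R by exact: ltW.
have s0 : 0 <= (norms (Pia0 T n - alpha0 M)%R)%:E by rewrite lee_fin norms_ge0.
have t0 : 0 <= tau T Aos n * (del n)%:E by rewrite mule_ge0 ?tau_ge0// lee_fin.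
have C1 : (1 <= 1 + D)%R by rewrite lerDl.
have main y : 0 <= y -> y <= (1 + D)%:E * y.
  by move=> y0; rewrite -[leLHS]mul1e lee_wpmul2r.
have st0 := adde_ge0 s0 t0.
set rate := _ + tau T Aos n * _ in st0 *.
have goal_le y : y <= rate -> y <= (1 + D)%:E * rate.
  by move=> /le_trans; apply; exact: main.
have [a0|aneq] := eqVneq (Nw (a - Pia0 T n)%R) 0.
  have tri : [\/ norms (a - alpha0 M)%R = 0%R, norms (a - Pia0 T n)%R = 0%R |
      tau T Aos n = +oo].
    by move: a Aa {a_le} a0; near: n; exact: null_trichotomy.
  case: tri => [->|p0|tauy].
  - by apply: goal_le.
  - apply: goal_le; apply: (@le_trans _ _ (norms (Pia0 T n - alpha0 M)%R)%:E).
      by rewrite lee_fin (le_trans (ler_norms_Pia0 T n a))// p0 addr0.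
    by rewrite /rate leeDl.
  - rewrite /rate tauy gt0_mulye ?lte_fin// addey//.
    by rewrite gt0_muley ?lte_fin ?ltr_pwDl// leey.
have Va := directions_sub Aa.1 Aos_alpha0.
have Vp := directions_sub Ap.1 Aos_alpha0.
have Vap := directions_sub Aa.1 Ap.1.
have aw : normw (a - Pia0 T n)%R <= (D * del n)%:E.
  apply: normw_le => //; first by rewrite mulr_ge0.
  have aE : (a - Pia0 T n = (-1) *: (Pia0 T n - alpha0 M) + (a - alpha0 M))%R.
    by rewrite scaleN1r opprB [RHS]addrC subrKA.
  apply: (le_trans (Nw_lin_le Vp Va Vap aE)).
  have : normw (a - alpha0 M)%R ^+ 2 <= ((C * del n) ^+ 2)%:E.
    have := poweR_ge0 (Nw (a - alpha0 M)%R) 2^-1; rewrite -normwE.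
    case: (normw _) a_le => [w| |]//; rewrite !lee_fin => wle w0.
    rewrite -[leLHS]expr2.
    by rewrite ler_pXn2r// nnegrE// mulr_ge0// ltW.
  rewrite normw_sqr// sqrrN expr1n mulr1 => a2_le.
  apply: (@le_trans _ _ (2%:E * (B * del n ^+ 2)%:E +
      2%:E * ((C * del n) ^+ 2)%:E)).
    by rewrite leeD// lee_wpmul2l.
  by rewrite -!EFinM -EFinD lee_fin !exprMn D2; lra.
have := norms_le_tau Aa Ap aneq aw; rewrite EFinM muleCA => n_le.
apply: (@le_trans _ _ ((norms (Pia0 T n - alpha0 M)%R)%:E +
    (norms (a - Pia0 T n)%R)%:E)).
  by rewrite -EFinD lee_fin ler_norms_Pia0.
rewrite /rate ge0_muleDr// leeD// ?main// (le_trans n_le)//.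
by rewrite lee_wpmul2r// lee_fin lerDr.
Unshelve. all: by end_near. Qed.

End LocalGeometry.

(** * Rates of convergence *)

Section Rates.
Variables (R : realType) (M : model R) (E : experiment M) (T : procedure M).
Local Notation par := ('rV[R]_(dtheta M) * Hsp M)%type.
Variables (bigO : (nat -> \bar R) -> dstat M -> Prop) (del : nat -> R).
Variables (Aos : set par) (M0 : R).
Hypotheses (hM : model_spec M) (hF : first_stage_spec E T)
  (hT : penalized_spec T) (hID : ID T) (hPEN : PEN T)
  (hL : LOC T bigO del Aos) (hA : local_nbhd T M0 Aos)
  (hB3 : BCRIT3 E T del Aos).
Hypotheses (del_gt0 : forall n, 0 < del n) (del_cvg0 : del @ \oo --> (0 : R)).
Hypotheses (M0_gt0 : 0 < M0) (Pen_alpha0 : (Pen T (alpha0 M).2 < M0%:E)%E)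
  (Pen_Pia0 : (\forall n \near \oo, Pen T (PiH T n) < M0%:E)%E).
Local Open Scope ereal_scope.

Variables (K : R) (est : forall n, sample M n -> n.-tuple R -> par).
Hypotheses (K_gt0 : (0 < K)%R) (K_ltM0 : (K < M0)%R).
Hypothesis est_Ak : forall n (z : sample M n) v, Ak T n (est z v).
Hypothesis est_crit : forall e : R, (0 < e)%R -> unlikely E e 0
  (fun n z => [set v | (K * lam T n)%:E < pcrit T z v (est z v)]).
Hypothesis est_near : forall eps e : R, (0 < eps)%R -> (0 < e)%R ->
  unlikely E e 0
    (fun n z => [set v | (eps <= norms (est z v - alpha0 M))%R]).

(** One bad event serves both rates. It leaves a probability [d] of exceptional
    data, which comes from the remainder in the lower bound for [Qn] alone: that
    remainder is tight in one reading and dominated in the other. *)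
Lemma rates_unlikely (c C d e : R) (r : dstat M) : (0 < c)%R -> (0 < C)%R ->
  (0 < e)%R -> (forall n (z : sample M n) a, Aosn T Aos n a ->
    c%:E * Q a - r n z <= (Qn T z a)%:E) ->
  unlikelyZ E d (fun n => [set z | C%:E * sq del n < `|r n z|]) ->
  (exists2 C' : R, (0 < C')%R & unlikely E e d (fun n z =>
     [set v | C'%:E * (del n)%:E < `|normw (est z v - alpha0 M)%R|])) /\
  (exists2 C' : R, (0 < C')%R & unlikely E e d (fun n z =>
     [set v | C'%:E * ((norms (Pia0 T n - alpha0 M)%R)%:E +
                       tau T Aos n * (del n)%:E) <
              `|(norms (est z v - alpha0 M)%R)%:E|])).
Proof.
move=> c0 C0 e0 rle rU; have [cB cB0 [rB rBO rBle]] := hB3.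
have [e1 e10 He1] := Aos_near hPEN hA M0_gt0.
have [c1 [c2 [c10 HQ]]] := Q_equiv hM hPEN hL hA M0_gt0 Pen_alpha0.
have e20 : (0 < e / 2)%R by rewrite divr_gt0.
have e40 : (0 < e / 2 / 2)%R by rewrite divr_gt0.
have e80 : (0 < e / 2 / 2 / 2)%R by rewrite divr_gt0.
have [CB CB0 rBU] := OPV_unlikely e20 rBO.
have := unlikelyU rBU (unlikelyU (est_crit e40)
  (unlikelyU (est_near e10 e80) (unlikelyZW (ltW e80) rU))).
rewrite !add0r -!splitr; set Bad := (X in unlikely _ _ _ X) => BadU.
(* Outside the bad event [c1 * Nw <= Q <= c1 * D * del n ^+ 2], by the two local
   lower bounds and [lam <= del n ^+ 2]. *)
pose D := (((K + CB) / cB + C) / c / c1)%R.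
have D0 : (0 < D)%R.
  by rewrite divr_gt0// divr_gt0// addr_gt0// divr_gt0// addr_gt0.
have event : \forall n \near \oo, forall (z : sample M n) v, ~ Bad n z v ->
    Aosn T Aos n (est z v) /\
    normw (est z v - alpha0 M)%R <= (Num.sqrt D * del n)%:E.
  near=> n => z v.
  move=> /not_orP[/negP + /not_orP[/negP + /not_orP[/negP + /negP +]]].
  rewrite -!leNgt -ltNge => rBx /(pcrit_le hF hT hPEN)[QBl PK] ne rx.
  have Aa : Aset (est z v) by case: (est_Ak z v).
  have Aest : Aosn T Aos n (est z v).
    split=> //; apply: He1 => //; apply: (le_lt_trans PK).
    by rewrite lte_fin.
  split => //.
  have [_ ld] : Q (Pia0 T n) <= sq del n /\ (lam T n <= del n ^+ 2)%R.
    by near: n; exact: (del_dominates hL).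
  have {}QBl : (QnB T z v (est z v) <= K * del n ^+ 2)%R.
    by rewrite (le_trans QBl)// ler_pM2l.
  have := Q_le_of_bounds hM c0 cB0 Aa (rle _ _ _ Aest) (rBle _ _ _ _ Aest)
    QBl rx rBx.
  have /andP[+ _] := HQ _ Aest.1; move=> /le_trans /[apply] Nle.
  have Va := directions_sub Aest.1 (Aos_alpha0 hM hPEN hA M0_gt0 Pen_alpha0).
  apply: (normw_le hM hL Va).
    by rewrite mulr_ge0 ?sqrtr_ge0// ltW.
  rewrite exprMn sqr_sqrtr ?(ltW D0)//.
  move: (Nw_ge0 hM hL Va) Nle; case: (Nw _) => [N|_|//].
    rewrite -EFinM !lee_fin => _; rewrite -ler_pdivlMl// => /le_trans; apply.
    by rewrite le_eqVlt /D; apply/orP; left; apply/eqP; field; rewrite !gt_eqF.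
  by rewrite gt0_muley ?lte_fin.
have sD0 : (0 < Num.sqrt D)%R by rewrite sqrtr_gt0.
split.
  exists (Num.sqrt D) => //; apply: sub_unlikely BadU.
  near=> n => z v /=; rewrite gee0_abs ?normwE ?poweR_ge0// -EFinM.
  apply: contraPP => nBad; apply/negP; rewrite -leNgt.
  suff [] : Aosn T Aos n (est z v) /\
    normw (est z v - alpha0 M)%R <= (Num.sqrt D * del n)%:E by [].
  by move: z v nBad; near: n.
have [C' C'0 HC'] := norms_le_rate hM hT hID hPEN hL hA del_gt0 del_cvg0 M0_gt0
  Pen_alpha0 Pen_Pia0 sD0.
exists C' => //; apply: sub_unlikely BadU.
near=> n => z v /=; rewrite ger0_norm ?norms_ge0//.
apply: contraPP => nBad; apply/negP; rewrite -leNgt.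
have [Aa aw] : Aosn T Aos n (est z v) /\
    normw (est z v - alpha0 M)%R <= (Num.sqrt D * del n)%:E.
  by move: z v nBad; near: n.
by move: (est z v) Aa aw; near: n.
Unshelve. all: by end_near. Qed.

Lemma rates_OPV : lower_bound T (OP_wpa1 E) (sq del) (Aosn T Aos) ->
  rates T (OPV E) del Aos (@est).
Proof.
move=> [c c0 [r /OP_wpa1_unlikely[C C0 rU] rle]].
by split; apply: unlikely_OPV => e e0;
  have [[C1 ? ?] [C2 ? ?]] := rates_unlikely c0 C0 e0 rle rU;
  [exists C1|exists C2].
Qed.

Lemma rates_OPV_tight : lower_bound T (OP E) (sq del) (Aosn T Aos) ->
  rates T (OPV_tight E) del Aos (@est).
Proof.
move=> [c c0 [r rO rle]].
by split; apply: unlikely_OPV_tight => e e0;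
  have [C C0 rU] := OP_unlikely (divr_gt0 e0 (ltr0Sn _ 1)) rO;
  have [[C1 ? ?] [C2 ? ?]] := rates_unlikely c0 C0 e0 rle rU;
  [exists C1|exists C2].
Qed.

End Rates.

Theorem lemmaA1 (R : realType) (M : model R) (E : experiment M)
    (T : procedure M) (dbar del dbars : nat -> R) :
  model_spec M -> experiment_spec E ->
  first_stage_spec E T -> penalized_spec T -> estimators_spec E T ->
  sequences_spec dbar del dbars ->
  ID T -> PEN T -> CRIT1 E T -> BCRIT1 E T ->
  \forall M0 \near +oo_R,
    bound_spec E T M0 -> CRIT2 E T dbar M0 -> BCRIT2 E T dbars M0 ->
    [/\ consistent E T (@alphaB R M T),
        consistent E T (@alphaRB R M T) &
        forall Aos, local_nbhd T M0 Aos -> BCRIT3 E T del Aos ->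
          (LOC T (OP_wpa1 E) del Aos ->
             rates T (OPV E) del Aos (@alphaB R M T) /\
             rates T (OPV E) del Aos (@alphaRB R M T)) /\
          (LOC T (OP E) del Aos ->
             rates T (OPV_tight E) del Aos (@alphaB R M T) /\
             rates T (OPV_tight E) del Aos (@alphaRB R M T))].
Proof.
move=> hM _ hF hT hEst [hpos [_ dbar0] [_ del0] [_ dbars0]] hID hPEN hC1 hB1.
have [K K0 crit] := criterion_bound hM hF hT hEst hID hPEN hC1 hB1.
have [Kp Kp0 HKp] := Pen_Pia0_bounded hT hPEN.
have [p0 p0E] : exists p : R, Pen T (alpha0 M).2 = p%:E.
  case: hPEN => _ [_ +] _; have := Pen_ge0 hT (alpha0 M).2.
  by case: (Pen T _) => [p _ _||]//; exists p.
have [BAk Bcrit] : beats_alphahat E T (@alphaB R M T) := alphaB_beats hEst.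
have [RAk Rcrit] : beats_alphahat E T (@alphaRB R M T) := alphaRB_beats hEst.
near=> M0 => _ hC2 hB2.
have KM : K < M0 by near: M0; apply: nbhs_pinfty_gt; exact: num_real.
have M00 : 0 < M0 by exact: lt_trans KM.
have pM : (Pen T (alpha0 M).2 < M0%:E)%E.
  by rewrite p0E lte_fin; near: M0; apply: nbhs_pinfty_gt; exact: num_real.
have PM : (\forall n \near \oo, Pen T (PiH T n) < M0%:E)%E.
  apply: filterS HKp => n /le_lt_trans; apply; rewrite lte_fin.
  by near: M0; apply: nbhs_pinfty_gt; exact: num_real.
have del_gt0 n : 0 < del n by case: (hpos n).
have critB := crit _ (alphaB_beats hEst).
have critR := crit _ (alphaRB_beats hEst).
have nearB := norms_unlikely hM hF hT hID hPEN BAk critB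
  dbar0 dbars0 (ltW KM) hC2 hB2.
have nearR := norms_unlikely hM hF hT hID hPEN RAk critR
  dbar0 dbars0 (ltW KM) hC2 hB2.
split.
- exact (consistency hM hF hT hID hPEN BAk critB K0
    dbar0 dbars0 (ltW KM) hC2 hB2).
- exact (consistency hM hF hT hID hPEN RAk critR K0
    dbar0 dbars0 (ltW KM) hC2 hB2).
move=> Aos hA hB3; split=> hL; case: (hL) => _ _ lb _; split.
- exact (rates_OPV hM hF hT hID hPEN hL hA hB3 del_gt0 del0 M00 pM PM
    K0 KM BAk critB nearB lb).
- exact (rates_OPV hM hF hT hID hPEN hL hA hB3 del_gt0 del0 M00 pM PM
    K0 KM RAk critR nearR lb).
- exact (rates_OPV_tight hM hF hT hID hPEN hL hA hB3 del_gt0 del0 M00 pM PM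
    K0 KM BAk critB nearB lb).
- exact (rates_OPV_tight hM hF hT hID hPEN hL hA hB3 del_gt0 del0 M00 pM PM
    K0 KM RAk critR nearR lb).
Unshelve. all: by end_near. Qed.
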